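(* Let $k\geq 2$ be an integer and let $M_k=[z^k-w^k]\subset H^2(\mathbb D^2)$. Then $\Sigma_0(M_k)=\frac{\pi^2}{6}$ and $$\Sigma_j(M_k)=\Sigma_{\lceil j/k\rceil}([z-w])\quad\text{for every integer } j\geq 1.$$ Equivalently, for every integer $m\geq 1$, $$\Sigma_{km-k+1}(M_k)=\Sigma_{km-k+2}(M_k)=\cdots=\Sigma_{km}(M_k)=\Sigma_m([z-w]).$$ In particular, the sequence $\{\Sigma_j(M_k)\}_{j\geq 0}$ is nonincreasing.
   Context: $H^2(\mathbb D^2)$ is the Hardy space of the bidisk with coordinates $(z,w)$, in which the monomials $z^aw^b$ ($a,b\ge 0$) form an orthonormal basis. For a polynomial $p$, $[p]$ denotes the closure of $p\,\mathbb C[z,w]$ in $H^2(\mathbb D^2)$; it is a submodule, i.e. a closed subspace invariant under multiplication by $z$ and $w$. For a submodule $M$, $R_1,R_2$ are the restrictions to $M$ of multiplication by $z$ and $w$, respectively, $[A,B]=AB-BA$, and $$\Sigma_0(M)=\|[R_2^*,R_2][R_1^*,R_1]\|_{H.S.}^2,\qquad \Sigma_1(M)=\|[R_1^*,R_2]\|_{H.S.}^2,$$ where $\|\cdot\|_{H.S.}$ is the Hilbert–Schmidt norm. Higher invariants for $M=[p]$, $p\neq0$ a homogeneous polynomial: let $A^n$ ($n\ge 0$) be the $(n+1)\times(n+1)$ matrix with entries $a_{i,l}=\langle p z^{l}w^{n-l},\,p z^{i}w^{n-i}\rangle$, $0\le i,l\le n$ (a Toeplitz matrix; $a_{i,l}=\langle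 pw^{i-l},pz^{i-l}\rangle$ for $i\ge l$). Let $A^n_{i,l}$ be the (signed) cofactor of the entry of $A^n$ in row $i$, column $l$ (rows and columns indexed from $0$; $A^0_{0,0}=1$), and let $D_0=1$, $D_n=\det A^{n-1}$ for $n\ge1$. Then $$\varphi_n=\frac{\sum_{l=0}^n A^n_{0,l}\,p\,z^lw^{n-l}}{\sqrt{D_nD_{n+1}}},\qquad \psi_n=\frac{\sum_{l=0}^n A^n_{n,l}\,p\,z^lw^{n-l}}{\sqrt{D_nD_{n+1}}},\qquad n\ge0,$$ are orthonormal bases of $M\ominus zM$ and $M\ominus wM$, respectively, each $\varphi_n,\psi_n$ being homogeneous of degree $n+\deg p$. For $j\ge 2$ one defines $$\Sigma_j(M)=\sum_{n=0}^\infty |\langle w^j\varphi_n, z^j\psi_n\rangle|^2,$$ and this formula also holds for $j=0,1$. *)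

(* Defs.v *)
From mathcomp Require Import all_boot all_order all_algebra.
From mathcomp Require Import all_classical all_reals all_analysis.
From mathcomp Require Import complex.

Set Implicit Arguments.
Unset Strict Implicit.
Unset Printing Implicit Defensive.

Import Order.TTheory GRing.Theory Num.Theory.
Import ComplexField numFieldNormedType.Exports.

Local Open Scope classical_set_scope.
Local Open Scope ring_scope.

Section Hardy.
Variable R : realType.
Local Notation C := R[i].

(** A power series in z and w is given by its coefficients: [f (a, b)] is the
    coefficient of z^a w^b.  H^2(D^2) is the subset [hardy2] of square-summable
    coefficient families. *)
Local Notation H := (nat * nat -> C).

Definition normsq (f : H) : \bar R :=
  \esum_(x in [set: nat * nat]) (Normc.normc (f x) ^+ 2)%:E.

Definition hardy2 : set H := [set f | (normsq f < +oo)%E].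

(** The sum over N^2 of [f x * (g x)^*] converges absolutely on [hardy2], so it
    is the limit of its partial sums over the squares [0, N)^2, taken
    separately for the real and imaginary parts. *)
Definition inner_partial (f g : H) (N : nat) : C :=
  \sum_(a < N) \sum_(b < N)
     f (val a, val b) * ((g (val a, val b))^*)%C.

Definition inner (f g : H) : C :=
  Complex (limn (fun N => complex.Re (inner_partial f g N)))
          (limn (fun N => complex.Im (inner_partial f g N))).

Definition mulz (f : H) : H :=
  fun x => if x.1 is a.+1 then f (a, x.2) else 0.

Definition mulw (f : H) : H :=
  fun x => if x.2 is b.+1 then f (x.1, b) else 0.

(** In [{poly {poly C}}] the outer variable ['X] is z and the inner variable
    ['X%:P] is w. *)
Local Notation z := ('X : {poly {poly C}}).
Local Notation w := ('X%:P : {poly {poly C}}).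

Definition of_poly (p : {poly {poly C}}) : H := fun x => p`_x.1`_x.2.

Definition submodule_gen (p : {poly {poly C}}) : set H :=
  [set f | hardy2 f /\ forall e : R, 0 < e ->
     exists q : {poly {poly C}}, (normsq (f - of_poly (p * q))%R < e%:E)%E].

Section Operators.
Variable M : set H.

(** Operators on [M] are represented by total maps on [H], of which only the
    restriction to [M] matters.  [adj T g] is the unique (by Riesz) element [h]
    of [M] such that <T f, g> = <f, h> for all f in [M]. *)
Definition adj (T : H -> H) (g : H) : H :=
  xget 0 [set h | M h /\ forall f, M f -> inner (T f) g = inner f h].

Definition commutator (A B : H -> H) : H -> H :=
  fun f => A (B f) - B (A f).

Definition orthonormal_basis (E : set H) : Prop :=
  [/\ E `<=` M,
      forall e, E e -> inner e e = 1,
      forall e e', E e -> E e' -> e <> e' -> inner e e' = 0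
    & forall f, M f -> forall eps : R, 0 < eps ->
        exists n (c : 'I_n -> C) (e : 'I_n -> H),
          (forall i, E (e i)) /\
          (normsq (f - \sum_(i < n) c i *: e i)%R < eps%:E)%E].

(** Squared Hilbert-Schmidt norm of an operator on [M]; the sum does not depend
    on the orthonormal basis, one of which is chosen. *)
Definition hs_normsq (T : H -> H) : \bar R :=
  \esum_(e in xget set0 orthonormal_basis) normsq (T e).

Definition Sigma0 : \bar R :=
  hs_normsq (commutator (adj mulw) mulw \o commutator (adj mulz) mulz).

Definition Sigma1 : \bar R := hs_normsq (commutator (adj mulz) mulw).

End Operators.

Section HigherInvariants.
Variable p : {poly {poly C}}.

Definition gram (n : nat) : 'M[C]_n.+1 :=
  \matrix_(i < n.+1, l < n.+1)
     inner (of_poly (p * z ^+ l * w ^+ (n - l)))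
           (of_poly (p * z ^+ i * w ^+ (n - i))).

Definition gram_det (n : nat) : C := if n is m.+1 then \det (gram m) else 1.

Definition cofactor_vector (n : nat) (i : 'I_n.+1) : H :=
  (sqrtC (gram_det n * gram_det n.+1))^-1 *:
  \sum_(l < n.+1)
     cofactor (gram n) i l *: of_poly (p * z ^+ l * w ^+ (n - l)).

Definition phi (n : nat) : H := cofactor_vector (ord0 : 'I_n.+1).
Definition psi (n : nat) : H := cofactor_vector (ord_max : 'I_n.+1).

Definition Sigma_higher (j : nat) : \bar R :=
  (\sum_(0 <= n <oo)
     (Normc.normc (inner (iter j mulw (phi n)) (iter j mulz (psi n))) ^+ 2)%:E)%E.

(** [Sigma j] is Sigma_j([p]) for a nonzero homogeneous polynomial [p]. *)
Definition Sigma (j : nat) : \bar R :=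
  match j with
  | 0 => Sigma0 (submodule_gen p)
  | 1 => Sigma1 (submodule_gen p)
  | _ => Sigma_higher j
  end.

End HigherInvariants.

Definition zk_sub_wk (k : nat) : {poly {poly C}} := z ^+ k - w ^+ k.

End Hardy.

(* Main.v *)
(** Multiplication by z^k - w^k only relates monomials of the same chain
    z^(a + i k) w^(b - i k), so M = [z^k - w^k] is the space of square-summable
    families whose sum over each chain vanishes.  On M the adjoint of
    multiplication by z is the backward shift corrected on each chain by a
    constant, and both operators defining Sigma_0 and Sigma_1 take the form
    (T f)(a, b) = c(a, b) f(0, a + b).  Evaluation at (0, n) on M is represented
    by the projection of z^0 w^n, of squared norm 1 - 1/L with L the length of
    the chain, and Parseval's identity gives the Hilbert-Schmidt norms.  For
    Sigma_j with j >= 2, phi_n and psi_n live on the chains through w^(n+k) and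
    z^(n+k); the coefficients of these vectors on the Gram family solve
    A^n c = gamma e_0, which determines cofactors and determinants.  Counting
    the monomials common to w^j phi_n and z^j psi_n yields
    Sigma_j(M) = sum_L ((L - c) / (L (L - 1)))^2 with c = ceil(j/k), and
    Sigma_0(M) = sum 1/m^2. *)
Require Import Defs.
From mathcomp Require Import all_boot all_order all_algebra.
From mathcomp Require Import all_classical all_reals all_analysis.
From mathcomp Require Import complex ring lra zify.

Set Implicit Arguments.
Unset Strict Implicit.
Unset Printing Implicit Defensive.

Import Order.TTheory GRing.Theory Num.Theory.
Import ComplexField numFieldNormedType.Exports.

Local Open Scope classical_set_scope.
Local Open Scope ring_scope.

(** * Sums over pairs of natural numbers *)

(** Both [adj] and [hs_normsq] select their values with [xget], so neither can be computed before a
    witness is known: the adjoint is exhibited by a formula, and an explicit orthonormal basis keeps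
    the Hilbert-Schmidt norm from being a sum over the default [set0]. The values are free of k
    because k enters only through divisibility. The operators behind Sigma_0 and Sigma_1 vanish off
    fixed residue classes of exponents mod k, and passing to quotients by k leaves the same double
    sum for every k. For j >= 2 exactly one n with k | n + j belongs to each chain length L >= 2. No
    determinant is expanded. In degree n + k the orthogonal complement of zM in M is a line, and it
    contains the projection of w^(n+k) to M. This gives a guess for phi_n up to scaling; the guess
    solves a Gram system, and Cramer's rule reads the cofactors off it. The value pi^2/6 is the
    Basel sum, which is proved from the sine function. *)

Lemma esum_antidiagonal (R : realType) (F : nat * nat -> \bar R) :
  (forall x, 0 <= F x)%E ->
  (\esum_(x in [set: nat * nat]) F x =
   \sum_(0 <= n <oo) \sum_(a < n.+1) F (val a, n - val a)%N)%E.
Proof.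
move=> F0; rewrite nneseries_esumT; last by move=> n; exact: sume_ge0.
transitivity (\esum_(n in [set: nat]) \esum_(a in `I_n.+1) F (a, n - a)%N)%E.
  rewrite esum_esum// (reindex_esum ([set: nat] `*`` (fun n => `I_n.+1)) _
    (fun x => (x.2, x.1 - x.2)%N))//.
  split=> //.
  - move=> [n a] [n' a']; rewrite !inE /= => -[_ an] [_ an'] [aa nn].
    have {}an : (a < n.+1)%N := an; have {}an' : (a' < n'.+1)%N := an'.
    by congr pair; lia.
  - move=> [a b] _; exists (a + b, a)%N; first by split => //=; lia.
    by rewrite /= addKn.
apply: eq_esum => n _; rewrite esum_fset//.
by rewrite -(fsbig_ord _ _ (fun a => F (a, n - a)%N)).
Qed.

(** This reindexing by quotients is the step at which k leaves the sums for Sigma_0 and Sigma_1. *)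
Lemma esum_multiples (R : realType) (k : nat) (G : nat * nat -> \bar R) :
  (0 < k)%N -> (forall x, 0 <= G x)%E ->
  (\esum_(x in [set: nat * nat])
     (if (k %| x.1)%N && (k %| x.2)%N then G (x.1 %/ k, x.2 %/ k)%N else 0) =
   \esum_(x in [set: nat * nat]) G x)%E.
Proof.
move=> k0 G0; rewrite (esumID [set x | (k %| x.1)%N && (k %| x.2)%N]) ?setTI; last first.
  by move=> x _; case: ifP.
rewrite [X in (_ + X)%E]esum1 ?adde0; last first.
  by move=> x /= /negP/negbTE ->.
rewrite (reindex_esum setT _ (fun x => (x.1 * k, x.2 * k)%N)).
  by apply: eq_esum => -[a b] _ /=; rewrite !dvdn_mull//= !mulnK.
split=> //=.
- by move=> [a b] _ /=; rewrite !dvdn_mull.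
- move=> [a b] [a' b'] _ _ /= [/eqP + /eqP].
  by rewrite !eqn_pmul2r// => /eqP-> /eqP->.
- move=> [a b] /= /andP[/dvdnP[s ->] /dvdnP[t ->]]; by exists (s, t).
Qed.

Lemma esum_shift1 (R : realType) (F : nat * nat -> \bar R) :
  (forall x, 0 <= F x)%E -> (forall b, F (0%N, b) = 0)%E ->
  (\esum_(x in [set: nat * nat]) F (x.1.+1, x.2) =
   \esum_(x in [set: nat * nat]) F x)%E.
Proof.
move=> F0 F00; rewrite [RHS](esumID [set x | (0 < x.1)%N]) ?setTI//.
rewrite [X in (_ + X)%E]esum1 ?adde0; last first.
  by move=> [[|a] b] na; [rewrite F00|have := na isT].
rewrite [RHS](reindex_esum setT _ (fun x => (x.1.+1, x.2)))//.
split=> //.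
- by move=> [a b] [a' b'] _ _ [-> ->].
- by move=> [[|a] b]// _; exists (a, b).
Qed.

(** * Square-summable coefficient families *)

Section SquaredModulus.
Variable R : realType.
Local Notation C := R[i].
Implicit Types x y : C.

Definition sqn x : R := Normc.normc x ^+ 2.

Lemma sqnE x : sqn x = complex.Re x ^+ 2 + complex.Im x ^+ 2.
Proof. by case: x => a b; rewrite /sqn /= sqr_sqrtr ?addr_ge0 ?sqr_ge0. Qed.

Lemma sqn_ge0 x : 0 <= sqn x.
Proof. exact: sqr_ge0. Qed.

Lemma sqn0 : sqn 0 = 0.
Proof. by rewrite sqnE /= expr0n addr0. Qed.

Lemma sqnM x y : sqn (x * y) = sqn x * sqn y.
Proof. by rewrite /sqn Normc.normcM exprMn. Qed.

Lemma sqnN x : sqn (- x) = sqn x.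
Proof. by rewrite !sqnE; case: x => a b /=; rewrite !sqrrN. Qed.

Lemma sqnV x : sqn x^-1 = (sqn x)^-1.
Proof. by rewrite /sqn Normc.normcV exprVn. Qed.

Lemma sqnJ x : sqn (x^*)%C = sqn x.
Proof. by rewrite !sqnE; case: x => a b /=; rewrite sqrrN. Qed.

Lemma sqn_real (r : R) : sqn (r%:C)%C = r ^+ 2.
Proof. by rewrite sqnE /= expr0n addr0. Qed.

Lemma sqn_eq0 x : (sqn x == 0) = (x == 0).
Proof.
rewrite sqnE paddr_eq0 ?sqr_ge0// !sqrf_eq0 eq_complex /=.
by case: x.
Qed.

Lemma mulcJ x : x * (x^*)%C = ((sqn x)%:C)%C.
Proof.
by rewrite sqnE; case: x => a b; simpc; congr Complex; ring.
Qed.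

Lemma ReD x y : complex.Re (x + y) = complex.Re x + complex.Re y.
Proof. by case: x y => [a b] [c d]. Qed.

Lemma ImD x y : complex.Im (x + y) = complex.Im x + complex.Im y.
Proof. by case: x y => [a b] [c d]. Qed.

Lemma ReM x y :
  complex.Re (x * y) = complex.Re x * complex.Re y - complex.Im x * complex.Im y.
Proof. by case: x y => [a b] [c d]. Qed.

Lemma ImM x y :
  complex.Im (x * y) = complex.Re x * complex.Im y + complex.Im x * complex.Re y.
Proof. by case: x y => [a b] [c d]. Qed.

Lemma Re_sum (I : Type) (r : seq I) (P : pred I) (F : I -> C) :
  complex.Re (\sum_(i <- r | P i) F i) = \sum_(i <- r | P i) complex.Re (F i).
Proof. exact: (big_morph _ ReD). Qed.

Lemma conjcD x y : ((x + y)^*)%C = (x^*)%C + (y^*)%C.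
Proof. exact: rmorphD. Qed.

Lemma conjcM x y : ((x * y)^*)%C = (x^*)%C * (y^*)%C.
Proof. exact: rmorphM. Qed.

Lemma conjcN x : ((- x)^*)%C = - (x^*)%C.
Proof. exact: rmorphN. Qed.

Lemma conjc_sum (I : Type) (r : seq I) (P : pred I) (F : I -> C) :
  ((\sum_(i <- r | P i) F i)^*)%C = \sum_(i <- r | P i) ((F i)^*)%C.
Proof. exact: rmorph_sum. Qed.

Lemma real_complexM (r s : R) : ((r * s)%:C)%C = (r%:C)%C * (s%:C)%C.
Proof. exact: rmorphM. Qed.

(** Componentwise, to match [inner], whose real and imaginary parts are separate real limits. *)
Definition cvgC (u : nat -> C) (l : C) :=
  ((fun n => complex.Re (u n)) @ \oo --> complex.Re l) /\
  ((fun n => complex.Im (u n)) @ \oo --> complex.Im l).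

Lemma cvgC_unique u l l' : cvgC u l -> cvgC u l' -> l = l'.
Proof.
move=> [a b] [c d]; apply/eqP; rewrite eq_complex.
by apply/andP; split; apply/eqP;
  [exact: (cvg_unique _ a c)|exact: (cvg_unique _ b d)].
Qed.

Lemma cvgCD u v l m : cvgC u l -> cvgC v m -> cvgC (fun n => u n + v n) (l + m).
Proof.
move=> [a b] [c d]; split.
  by rewrite ReD; under eq_fun do rewrite ReD; exact: cvgD.
by rewrite ImD; under eq_fun do rewrite ImD; exact: cvgD.
Qed.

Lemma cvgCZ c u l : cvgC u l -> cvgC (fun n => c * u n) (c * l).
Proof.
move=> [a b]; split.
  by rewrite ReM; under eq_fun do rewrite ReM; apply: cvgB; exact: cvgMr.
by rewrite ImM; under eq_fun do rewrite ImM; apply: cvgD; exact: cvgMr.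
Qed.

Lemma cvgCJ u l : cvgC u l -> cvgC (fun n => (u n)^*)%C (l^*)%C.
Proof.
move=> [a b]; split.
  have -> : complex.Re (l^*)%C = complex.Re l by case: l {a b}.
  rewrite (_ : (fun n => _) = (fun n => complex.Re (u n)))//.
  by apply/funext => n; case: (u n).
have -> : complex.Im (l^*)%C = - complex.Im l by case: l {a b}.
rewrite (_ : (fun n => _) = (fun n => - complex.Im (u n))); first exact: cvgN.
by apply/funext => n; case: (u n).
Qed.

Lemma cvgC_near_cst u l N : (forall n, (N <= n)%N -> u n = l) -> cvgC u l.
Proof.
move=> ul; split; apply: cvg_near_cst; near=> n; rewrite ul//;
  near: n; exact: nbhs_infty_ge.
Unshelve. all: by end_near. Qed.

End SquaredModulus.

(** * The squared norm and the inner product of H^2 *)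

Section SquareSummable.
Variable R : realType.
Local Notation C := R[i].
Local Notation H := (nat * nat -> C).
Implicit Types (f g h : H) (N : nat).

Definition normsq_partial f N : R :=
  \sum_(a < N) \sum_(b < N) sqn (f (val a, val b)).

Lemma normsq_partialE f N : ((normsq_partial f N)%:E =
  \sum_(x \in `I_N `*` `I_N) (sqn (f x))%:E)%E.
Proof.
transitivity (\sum_(a \in `I_N) \sum_(b \in `I_N) (sqn (f (a, b)))%:E)%E.
  rewrite /normsq_partial -sumEFin -(fsbig_ord _ _ (fun a => \sum_(b \in `I_N) _)%E).
  by apply: eq_bigr => a _; rewrite -sumEFin -fsbig_ord.
rewrite pair_fsbig//; apply: eq_fsbigr => -[a b] _ //=.
Qed.

Lemma normsq_partial_le f N : ((normsq_partial f N)%:E <= normsq f)%E.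
Proof.
rewrite normsq_partialE; apply: esum_ge; exists (`I_N `*` `I_N) => //.
by split => //; exact: finite_setX.
Qed.

(** Every finite set of exponents lies in a square, so the squares used by [inner_partial] control
    the unordered sum. *)
Lemma normsq_le f (B : R) :
  (forall N, normsq_partial f N <= B) -> (normsq f <= B%:E)%E.
Proof.
move=> fB; apply: ge_ereal_sup => _ [X [finX _] <-].
have [N XN] : exists N, X `<=` `I_N `*` `I_N.
  exists (\max_(x <- finmap.enum_fset (fset_set X)) (x.1 + x.2)).+1 => x Xx.
  have : (x.1 + x.2 <= \max_(x <- finmap.enum_fset (fset_set X)) (x.1 + x.2))%N.
    apply: (@leq_bigmax_seq _ _ _ (fun x => x.1 + x.2)%N) => //.
    by rewrite in_fset_set// inE.
  by rewrite /setX /=; split; lia.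
apply: (@le_trans _ _ (normsq_partial f N)%:E); last by rewrite lee_fin.
rewrite normsq_partialE; apply: lee_fsum_nneg_subset => //.
- exact: finite_setX.
- by move=> x; rewrite !inE; exact: XN.
- by move=> x _; rewrite lee_fin sqn_ge0.
Qed.

Lemma normsq_ge0 f : (0 <= normsq f)%E.
Proof. by apply: esum_ge0 => x _; rewrite lee_fin sqn_ge0. Qed.

Lemma hardy2_bound f (B : R) :
  (forall N, normsq_partial f N <= B) -> hardy2 f.
Proof. by move=> /normsq_le fB; apply: le_lt_trans fB _; rewrite ltry. Qed.

(** The squared norm as a real number, with default value 0 for families outside [hardy2]. *)
Definition nrm f : R := fine (normsq f).

Lemma nrmE f : hardy2 f -> normsq f = (nrm f)%:E.
Proof. by move=> hf; rewrite /nrm fineK// ge0_fin_numE// normsq_ge0. Qed.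

Lemma nrm_ge0 f : 0 <= nrm f.
Proof. exact/fine_ge0/normsq_ge0. Qed.

Lemma normsq_partial_le_nrm f N : hardy2 f -> normsq_partial f N <= nrm f.
Proof. by move=> hf; rewrite -lee_fin -nrmE// normsq_partial_le. Qed.

Lemma nrm_le f (B : R) : (forall N, normsq_partial f N <= B) -> nrm f <= B.
Proof.
by move=> fB; rewrite -lee_fin -nrmE; [exact: normsq_le|exact: hardy2_bound fB].
Qed.

Lemma normsq_partial_cvg f : hardy2 f -> normsq_partial f @ \oo --> nrm f.
Proof.
move=> hf.
have nd : {homo normsq_partial f : n m / (n <= m)%N >-> n <= m}.
  move=> n m nm; rewrite -lee_fin !normsq_partialE; apply: lee_fsum_nneg_subset => //.
  - exact: finite_setX.
  - exact: finite_setX.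
  - by move=> x; rewrite !inE /setX /=; lia.
  - by move=> x _; rewrite lee_fin sqn_ge0.
have ub : has_ubound (range (normsq_partial f)).
  by exists (nrm f) => _ [N _ <-]; exact: normsq_partial_le_nrm.
have := nondecreasing_cvgn nd ub; set s := sup _ => cvs.
suff -> : nrm f = s by [].
apply/eqP; rewrite eq_le; apply/andP; split.
  by apply: nrm_le => N; apply: ub_le_sup => //; exists N.
by apply: ge_sup; [exists (normsq_partial f 0), 0%N|
  move=> _ [N _ <-]; exact: normsq_partial_le_nrm].
Qed.

Lemma sqn_le_nrm f x : hardy2 f -> sqn (f x) <= nrm f.
Proof.
case: x => a b hf; have := @normsq_partial_le_nrm f (a + b).+1 hf.
apply: le_trans; rewrite /normsq_partial.
have ha : (a < (a + b).+1)%N by lia.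
have hb : (b < (a + b).+1)%N by lia.
rewrite (bigD1 (Ordinal ha))//= (bigD1 (Ordinal hb))//= -addrA lerDl.
by rewrite addr_ge0// ?sumr_ge0// => i _; rewrite ?sumr_ge0// => *; exact: sqn_ge0.
Qed.

Lemma nrm0_eq0 f : hardy2 f -> nrm f = 0 -> f = 0.
Proof.
move=> hf f0; apply/funext => x; apply/eqP; rewrite -sqn_eq0 eq_le sqn_ge0 andbT.
by rewrite -f0 sqn_le_nrm.
Qed.

Lemma sqnD_le (x y : C) : sqn (x + y) <= 2 * sqn x + 2 * sqn y.
Proof.
rewrite !sqnE; case: x y => [a b] [c d] /=.
by have := sqr_ge0 (a - c); have := sqr_ge0 (b - d); nra.
Qed.

Lemma hardy2D f g : hardy2 f -> hardy2 g -> hardy2 (f + g).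
Proof.
move=> hf hg; apply: (@hardy2_bound _ (2 * nrm f + 2 * nrm g)) => N.
apply: (@le_trans _ _ (2 * normsq_partial f N + 2 * normsq_partial g N)).
  rewrite /normsq_partial !mulr_sumr -big_split /=; apply: ler_sum => a _.
  rewrite !mulr_sumr -big_split /=; apply: ler_sum => b _; exact: sqnD_le.
by apply: lerD; rewrite ler_pM2l// normsq_partial_le_nrm.
Qed.

Lemma normsq_partialZ c f N :
  normsq_partial (c *: f) N = sqn c * normsq_partial f N.
Proof.
rewrite /normsq_partial !mulr_sumr; apply: eq_bigr => a _.
by rewrite !mulr_sumr; apply: eq_bigr => b _; rewrite -sqnM.
Qed.

Lemma hardy2Z c f : hardy2 f -> hardy2 (c *: f).
Proof.
move=> hf; apply: (@hardy2_bound _ (sqn c * nrm f)) => N.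
by rewrite normsq_partialZ ler_wpM2l ?sqn_ge0// normsq_partial_le_nrm.
Qed.

Lemma hardy2N f : hardy2 f -> hardy2 (- f).
Proof. by rewrite -scaleN1r; exact: hardy2Z. Qed.

Lemma hardy2B f g : hardy2 f -> hardy2 g -> hardy2 (f - g).
Proof. by move=> hf hg; apply: hardy2D => //; exact: hardy2N. Qed.

Lemma hardy2_fin f D :
  (forall a b, (D <= a)%N || (D <= b)%N -> f (a, b) = 0) -> hardy2 f.
Proof.
move=> f0; apply: (@hardy2_bound _ (normsq_partial f D)) => N.
rewrite -lee_fin !normsq_partialE.
rewrite (fsbigID [set x | x \in `I_D `*` `I_D])/=; last exact: finite_setX.
rewrite [X in (_ + X)%E]fsbig1 ?adde0; last first.
  move=> [a b] [_ /= nab]; rewrite f0 ?sqn0//; apply/negPn/negP => ab.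
  by apply: nab; rewrite inE /setX /=; lia.
apply: lee_fsum_nneg_subset => //.
- exact/finite_setIl/finite_setX.
- exact: finite_setX.
- by move=> x; rewrite !inE => -[_ /=]; rewrite inE.
- by move=> x _; rewrite lee_fin sqn_ge0.
Qed.

Lemma hardy20 : hardy2 (0 : H).
Proof. exact: (@hardy2_fin _ 0). Qed.

Lemma hardy2_sum (I : Type) (r : seq I) (F : I -> H) :
  (forall i, hardy2 (F i)) -> hardy2 (\sum_(i <- r) F i).
Proof. by move=> hF; elim/big_ind: _ => // *; [exact: hardy20|exact: hardy2D]. Qed.

Lemma inner_partialDl f g h N :
  inner_partial (f + g) h N = inner_partial f h N + inner_partial g h N.
Proof.
rewrite /inner_partial -big_split; apply: eq_bigr => a _ /=.
by rewrite -big_split; apply: eq_bigr => b _ /=; rewrite -mulrDl.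
Qed.

Lemma inner_partialZl c f g N :
  inner_partial (c *: f) g N = c * inner_partial f g N.
Proof.
rewrite /inner_partial mulr_sumr; apply: eq_bigr => a _ /=.
by rewrite mulr_sumr; apply: eq_bigr => b _ /=; rewrite mulrA.
Qed.

Lemma inner_partialC f g N : inner_partial f g N = ((inner_partial g f N)^*)%C.
Proof.
rewrite /inner_partial conjc_sum; apply: eq_bigr => a _ /=.
by rewrite conjc_sum; apply: eq_bigr => b _ /=; rewrite conjcM conjcK mulrC.
Qed.

Lemma inner_partialff f N : inner_partial f f N = ((normsq_partial f N)%:C)%C.
Proof.
rewrite /normsq_partial rmorph_sum; apply: eq_bigr => a _ /=.
by rewrite rmorph_sum; apply: eq_bigr => b _ /=; rewrite mulcJ.
Qed.

Lemma Re_inner_partial f g N : complex.Re (inner_partial f g N) =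
  4^-1 * (normsq_partial (f + g) N - normsq_partial (f - g) N).
Proof.
rewrite /inner_partial /normsq_partial Re_sum -sumrB mulr_sumr.
apply: eq_bigr => a _; rewrite Re_sum -sumrB mulr_sumr; apply: eq_bigr => b _.
rewrite -[(f + g) _]/(f _ + g _) -[(f - g) _]/(f _ - g _) !sqnE.
by case: (f _) (g _) => [x y] [z t] /=; field.
Qed.

(* By polarization, convergence reduces to that of the monotone partial sums
   of squared norms. *)
Lemma inner_cvg f g : hardy2 f -> hardy2 g ->
  cvgC (inner_partial f g) (inner f g).
Proof.
have reC f' g' : hardy2 f' -> hardy2 g' ->
    cvgn (fun N => complex.Re (inner_partial f' g' N)).
  move=> hf hg; apply/cvg_ex; exists (4^-1 * (nrm (f' + g') - nrm (f' - g'))).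
  under eq_fun do rewrite Re_inner_partial.
  apply: cvgMr; apply: cvgB; apply: normsq_partial_cvg;
    [exact: hardy2D|exact: hardy2B].
move=> hf hg; split; first exact: reC.
(* Multiplication by -i turns the imaginary part into a real part, which is already treated. *)
have imE N : complex.Im (inner_partial f g N) =
    complex.Re (inner_partial ((- 'i)%C *: f) g N).
  rewrite inner_partialZl; case: (inner_partial f g N) => x y /=.
  by rewrite !mulNr mul1r mul0r oppr0 sub0r opprK.
rewrite /inner /= (funext imE).
by apply: reC => //; exact: hardy2Z.
Qed.

Lemma inner_lim f g (l : C) : hardy2 f -> hardy2 g ->
  cvgC (inner_partial f g) l -> inner f g = l.
Proof. by move=> hf hg; apply: cvgC_unique; exact: inner_cvg. Qed.

Lemma innerDl f g h : hardy2 f -> hardy2 g -> hardy2 h ->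
  inner (f + g) h = inner f h + inner g h.
Proof.
move=> hf hg hh; apply: inner_lim => //; first exact: hardy2D.
rewrite (_ : inner_partial _ _ = fun N => inner_partial f h N + inner_partial g h N).
  by apply: cvgCD; exact: inner_cvg.
by apply/funext => N; exact: inner_partialDl.
Qed.

Lemma innerZl c f g : hardy2 f -> hardy2 g -> inner (c *: f) g = c * inner f g.
Proof.
move=> hf hg; apply: inner_lim => //; first exact: hardy2Z.
rewrite (_ : inner_partial _ _ = fun N => c * inner_partial f g N).
  by apply: cvgCZ; exact: inner_cvg.
by apply/funext => N; exact: inner_partialZl.
Qed.

Lemma innerC f g : hardy2 f -> hardy2 g -> inner f g = ((inner g f)^*)%C.
Proof.
move=> hf hg; apply: inner_lim => //.
rewrite (_ : inner_partial _ _ = fun N => ((inner_partial g f N)^*)%C).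
  by apply: cvgCJ; exact: inner_cvg.
by apply/funext => N; exact: inner_partialC.
Qed.

Lemma innerff f : hardy2 f -> inner f f = ((nrm f)%:C)%C.
Proof.
move=> hf; apply: inner_lim => //; split => /=.
  rewrite (_ : (fun n => _) = normsq_partial f); first exact: normsq_partial_cvg.
  by apply/funext => N; rewrite inner_partialff.
rewrite (_ : (fun n => _) = fun=> 0); first exact: cvg_cst.
by apply/funext => N; rewrite inner_partialff.
Qed.

Lemma inner0l g : hardy2 g -> inner 0 g = 0.
Proof.
move=> hg; rewrite -[X in inner X _](scale0r (0 : H)) innerZl ?mul0r//.
exact: hardy20.
Qed.

Lemma innerNl f g : hardy2 f -> hardy2 g -> inner (- f) g = - inner f g.
Proof. by move=> hf hg; rewrite -scaleN1r innerZl// mulN1r. Qed.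

Lemma innerBl f g h : hardy2 f -> hardy2 g -> hardy2 h ->
  inner (f - g) h = inner f h - inner g h.
Proof. by move=> hf hg hh; rewrite innerDl ?innerNl//; exact: hardy2N. Qed.

Lemma inner_suml (I : Type) (r : seq I) (F : I -> H) h :
  (forall i, hardy2 (F i)) -> hardy2 h ->
  inner (\sum_(i <- r) F i) h = \sum_(i <- r) inner (F i) h.
Proof.
move=> hF hh; elim: r => [|i r IHr]; first by rewrite !big_nil inner0l.
by rewrite !big_cons innerDl ?IHr//; exact: hardy2_sum.
Qed.

Lemma innerDr f g h : hardy2 f -> hardy2 g -> hardy2 h ->
  inner h (f + g) = inner h f + inner h g.
Proof.
move=> hf hg hh; rewrite innerC// ?innerDl// ?conjcD -?innerC//.
exact: hardy2D.
Qed.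

Lemma innerZr c f g : hardy2 f -> hardy2 g ->
  inner g (c *: f) = (c^*)%C * inner g f.
Proof.
move=> hf hg; rewrite innerC// ?innerZl// ?conjcM -?innerC//.
exact: hardy2Z.
Qed.

Lemma innerBr f g h : hardy2 f -> hardy2 g -> hardy2 h ->
  inner h (f - g) = inner h f - inner h g.
Proof.
move=> hf hg hh; rewrite innerC// ?innerBl// ?conjcD ?conjcN -?innerC//.
exact: hardy2B.
Qed.

Lemma nrmD f g : hardy2 f -> hardy2 g ->
  nrm (f + g) = nrm f + nrm g + 2 * complex.Re (inner f g).
Proof.
move=> hf hg; have hD := hardy2D hf hg.
have : ((nrm (f + g))%:C)%C = inner f f + inner g g + (inner f g + (inner f g)^*)%C.
  by rewrite -innerff// innerDl// !innerDr// (@innerC g f)//; ring.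
rewrite !innerff//; case: (inner f g) => x y; simpc => -[->] /=; ring.
Qed.

Lemma nrmZ c f : hardy2 f -> nrm (c *: f) = sqn c * nrm f.
Proof.
move=> hf; have hc := hardy2Z c hf.
have : ((nrm (c *: f))%:C)%C = ((sqn c * nrm f)%:C)%C.
  by rewrite -innerff// innerZl// innerZr// mulrA mulcJ innerff// real_complexM.
by case.
Qed.

Lemma cauchy_schwarz f g : hardy2 f -> hardy2 g ->
  sqn (inner f g) <= nrm f * nrm g.
Proof.
move=> hf hg; have [g0|g0] := eqVneq (nrm g) 0.
  have h0 := hardy20; rewrite (nrm0_eq0 hg g0) innerC// inner0l// sqnJ sqn0.
  by rewrite mulr_ge0 ?nrm_ge0.
have gt0 : 0 < nrm g by rewrite lt_neqAle eq_sym g0 nrm_ge0.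
(* This multiple makes [f + c *: g] orthogonal to [g]; nonnegativity of its squared norm is the
   claim. *)
pose c := - ((nrm g)^-1%:C)%C * inner f g.
have hc := hardy2Z c hg; have := nrm_ge0 (f + c *: g).
rewrite nrmD// nrmZ// innerZr// /c sqnM sqnN sqn_real sqnE.
case: (inner f g) => x y /=; simpc => h.
have : 0 <= (nrm f - (nrm g)^-1 * (x ^+ 2 + y ^+ 2)).
  by apply: le_trans h _; rewrite le_eqVlt; apply/orP; left; apply/eqP; field.
by rewrite subr_ge0 ler_pdivrMl// mulrC.
Qed.

Lemma inner_fin f g D :
  (forall a b, (D <= a)%N || (D <= b)%N -> f (a, b) * ((g (a, b))^*)%C = 0) ->
  inner f g = inner_partial f g D.
Proof.
move=> fg0.
have h : cvgC (inner_partial f g) (inner_partial f g D).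
  apply: (@cvgC_near_cst _ _ _ D) => N DN; rewrite /inner_partial.
  rewrite (big_ord_widen_cond N xpredT
    (fun a => \sum_(b < D) f (a, val b) * ((g (a, val b))^*)%C) DN).
  rewrite [LHS](bigID (fun a : 'I_N => (a < D)%N)) /= [X in _ + X]big1 ?addr0; last first.
    by move=> a; rewrite -leqNgt => Da; apply: big1 => b _; rewrite fg0 ?Da.
  apply: eq_bigr => a aD.
  rewrite (big_ord_widen_cond N xpredT (fun b => f (val a, b) * ((g (val a, b))^*)%C) DN).
  rewrite [LHS](bigID (fun b : 'I_N => (b < D)%N)) /= [X in _ + X]big1 ?addr0//.
  by move=> b; rewrite -leqNgt => Db; rewrite fg0 ?Db ?orbT.
case: h => h1 h2; rewrite /inner; apply/eqP; rewrite eq_complex /=.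
by apply/andP; split; apply/eqP; apply: cvg_lim.
Qed.

Definition delta (x : nat * nat) : H := fun y => (y == x)%:R.

Lemma hardy2_delta x : hardy2 (delta x).
Proof.
case: x => a b; apply: (@hardy2_fin _ (a + b).+1) => c d cd; rewrite /delta.
by case: eqP => // -[? ?]; lia.
Qed.

Lemma inner_delta f x : inner f (delta x) = f x.
Proof.
case: x => a b; rewrite (@inner_fin _ _ (a + b).+1); last first.
  move=> c d cd; rewrite /delta; case: eqP => [[? ?]|_]; first lia.
  by rewrite conjc0 mulr0.
have ha : (a < (a + b).+1)%N by lia.
have hb : (b < (a + b).+1)%N by lia.
rewrite /inner_partial (bigD1 (Ordinal ha))//= (bigD1 (Ordinal hb))//=.
rewrite /delta eqxx conjc1 mulr1 !big1 ?addr0//.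
  move=> c ca; rewrite big1// => d _.
  case: eqP => [[ac bd]|_]; last by rewrite conjc0 mulr0.
  by move: ca; rewrite -val_eqE /= ac eqxx.
move=> d db; case: eqP => [[bd]|_]; last by rewrite conjc0 mulr0.
by move: db; rewrite -val_eqE /= bd eqxx.
Qed.

End SquareSummable.

(** * Orthonormal bases and Hilbert-Schmidt norms *)

Section Parseval.
Variable R : realType.
Local Notation C := R[i].
Local Notation H := (nat * nat -> C).
Implicit Types (f g h e : H) (s : seq H).

Definition orthonormal_seq s := [/\ uniq s, {in s, forall e, hardy2 e},
  {in s, forall e, inner e e = 1} &
  {in s &, forall e e', e <> e' -> inner e e' = 0}].

Definition proj s g : H := \sum_(e <- s) inner g e *: e.

Lemma hardy2_proj s g : orthonormal_seq s -> hardy2 (proj s g).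
Proof.
move=> [_ hs _ _]; rewrite /proj big_seq; elim/big_ind: _ => [|? ? ? ?|e es].
- exact: hardy20.
- exact: hardy2D.
- by apply: hardy2Z; exact: hs.
Qed.

Lemma inner_projl s g h : orthonormal_seq s -> hardy2 h ->
  inner (proj s g) h = \sum_(e <- s) inner g e * inner e h.
Proof.
move=> [_ hs _ _] hh; rewrite /proj; elim: s hs => [|e s IHs] hs.
  by rewrite !big_nil inner0l.
have he : hardy2 e by apply: hs; rewrite mem_head.
have hs' : {in s, forall e, hardy2 e} by move=> x xs; apply: hs; rewrite inE xs orbT.
rewrite !big_cons innerDl ?innerZl ?IHs//; first exact: hardy2Z.
rewrite big_seq; elim/big_ind: _ => [|? ? ? ?|x xs].
- exact: hardy20.
- exact: hardy2D.
- by apply: hardy2Z; exact: hs'.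
Qed.

Lemma inner_residual s g e : orthonormal_seq s -> hardy2 g -> e \in s ->
  inner (g - proj s g) e = 0.
Proof.
move=> os hg es; have [us hs h1 h0] := os.
rewrite innerBl// ?inner_projl//; do ?exact: hardy2_proj; do ?exact: hs.
rewrite (bigD1_seq e)//= h1// mulr1 big_seq_cond big1 ?addr0 ?subrr//.
by move=> x /andP[xs /eqP xe]; rewrite (h0 x e)// mulr0.
Qed.

(** Pythagoras, the residual being orthogonal to [proj s g]. Nonnegativity of the left side is
    Bessel's inequality. *)
Lemma nrm_residual s g : orthonormal_seq s -> hardy2 g ->
  nrm (g - proj s g) = nrm g - \sum_(e <- s) sqn (inner g e).
Proof.
move=> os hg; have [us hs h1 h0] := os; have hp := hardy2_proj g os.
have hr := hardy2B hg hp.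
have rp : inner (g - proj s g) (proj s g) = 0.
  rewrite innerC// inner_projl// big_seq big1 ?conjc0// => e es.
  by rewrite (@innerC _ e)// ?inner_residual ?conjc0 ?mulr0//; exact: hs.
have : ((nrm (g - proj s g))%:C)%C = ((nrm g - \sum_(e <- s) sqn (inner g e))%:C)%C.
  rewrite -innerff// innerBr// rp subr0 innerBl// innerff// inner_projl//.
  rewrite rmorphB rmorph_sum big_seq [in RHS]big_seq; congr (_ - _).
  by apply: eq_bigr => e es; rewrite (@innerC _ e)// ?mulcJ//; exact: hs.
by case.
Qed.

(** The difference of [proj s g] and another combination is orthogonal to the residual. This carries
    the approximations granted by [orthonormal_basis] over to Fourier sums. *)
Lemma nrm_residual_min s g n (c : 'I_n -> C) (e : 'I_n -> H) :
  orthonormal_seq s -> hardy2 g -> (forall i, e i \in s) ->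
  nrm (g - proj s g) <= nrm (g - \sum_(i < n) c i *: e i).
Proof.
move=> os hg es; have [us hs h1 h0] := os; have hp := hardy2_proj g os.
have he i : hardy2 (c i *: e i) by apply: hardy2Z; exact: hs.
have hu : hardy2 (\sum_(i < n) c i *: e i) by exact: hardy2_sum.
have hr := hardy2B hg hp; have hv := hardy2B hp hu.
set r := g - proj s g in hr *; set u := \sum_(i < n) _ in hu hv *.
have -> : g - u = r + (proj s g - u) by rewrite addrA subrK.
have r0 : inner r (proj s g - u) = 0.
  rewrite innerC// innerBl// inner_projl// inner_suml// big_seq !big1 ?subr0 ?conjc0//.
    move=> i _; rewrite innerZl// ?(@innerC _ (e i))// ?inner_residual//; do ?exact: hs.
    by rewrite conjc0 mulr0.
  by move=> x xs; rewrite (@innerC _ x)// ?inner_residual ?conjc0 ?mulr0//; exact: hs.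
by rewrite nrmD// r0 /= mulr0 addr0 lerDl nrm_ge0.
Qed.

Lemma parseval (M E : set H) g : M `<=` @hardy2 R -> orthonormal_basis M E ->
  M g -> (\esum_(e in E) (sqn (inner g e))%:E = normsq g)%E.
Proof.
move=> Mh [EM E1 E0 Eap] Mg; have hg := Mh _ Mg.
have onE s : uniq s -> {in s, forall e, E e} -> orthonormal_seq s.
  move=> us sE; split => //; first by move=> e /sE /EM /Mh.
    by move=> e /sE /E1.
  by move=> e e' /sE Ee /sE Ee'; exact: E0.
rewrite nrmE//; apply/eqP; rewrite eq_le; apply/andP; split.
  apply: ge_ereal_sup => _ [X [finX XE] <-]; rewrite fsbig_finite//= sumEFin lee_fin.
  rewrite -subr_ge0 -nrm_residual// ?nrm_ge0//; apply: onE; first exact: finmap.fset_uniq.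
  by move=> e; rewrite in_fset_set// inE => /XE.
apply/lee_addgt0Pr => eps eps0.
have [n [c [e [eE]]]] := Eap g Mg eps eps0; set u := \sum_(i < n) _ => ueps.
(* The approximating vectors may repeat, whereas an orthonormal list must be free of duplicates. *)
pose s := undup [seq e i | i <- enum 'I_n].
have sE : {in s, forall x, E x}.
  by move=> x; rewrite mem_undup => /mapP[i _ ->].
have os : orthonormal_seq s by apply: onE => //; exact: undup_uniq.
have hu : hardy2 u by apply: hardy2_sum => i; apply/hardy2Z/Mh/EM/eE.
have les : nrm (g - proj s g) <= nrm (g - u).
  by apply: nrm_residual_min => // i; rewrite mem_undup map_f// mem_enum.
move: ueps; rewrite nrmE ?lte_fin; last exact: hardy2B.
move=> ueps; have := le_lt_trans les ueps; rewrite nrm_residual// => gs.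
apply: (@le_trans _ _ ((\sum_(x <- s) sqn (inner g x))%:E + eps%:E)%E).
  by rewrite -EFinD lee_fin; lra.
apply: leeD => //; apply: esum_ge; exists [set` s].
  by split; [exact: finite_seq|move=> x /sE].
by rewrite -sumEFin -fsbig_seq//; case: os.
Qed.

(* [K x] represents the functional [f |-> T f x]; Tonelli's theorem and
   Parseval's identity for each [K x] make the chosen basis irrelevant. *)
Lemma hs_normsq_kernel (M : set H) (T : H -> H) (K : nat * nat -> H) :
  M `<=` @hardy2 R -> (exists E, orthonormal_basis M E) ->
  (forall x, M (K x)) -> (forall f x, M f -> T f x = inner f (K x)) ->
  hs_normsq M T = (\esum_(x in [set: nat * nat]) normsq (K x))%E.
Proof.
move=> Mh exE MK TK; rewrite /hs_normsq.
have bE : orthonormal_basis M (xget set0 (orthonormal_basis M)).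
  by have [E hE] := exE; exact: (xgetI set0 hE).
set E := xget _ _ in bE *.
transitivity (\esum_(e in E) \esum_(x in [set: nat * nat]) (sqn (inner (K x) e))%:E)%E.
  apply: eq_esum => e Ee; apply: eq_esum => x _; congr EFin.
  have Me : M e by case: bE => EM _ _ _; exact: EM.
  rewrite -[LHS]/(sqn (T e x)) TK// innerC ?sqnJ//; apply: Mh => //; exact: MK.
rewrite esum_esum; last by move=> *; rewrite lee_fin sqn_ge0.
rewrite (reindex_esum ([set: nat * nat] `*`` (fun=> E)) _ (fun x => (x.2, x.1))).
- rewrite -(@esum_esum _ _ _ _ _ (fun x e => (sqn (inner (K x) e))%:E)).
    by apply: eq_esum => x _; exact: (parseval Mh bE (MK x)).
  by move=> *; rewrite lee_fin sqn_ge0.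
- split.
  + by move=> [x e] [_ Ee].
  + by move=> [x e] [y e'] _ _ [-> ->].
  + by move=> [e x] [Ee _]; exists (x, e).
Qed.

End Parseval.

(** * Submodules generated by a polynomial *)

Section PolynomialSubmodules.
Variable R : realType.
Local Notation C := R[i].
Local Notation H := (nat * nat -> C).
Local Notation z := ('X : {poly {poly C}}).
Local Notation w := ('X%:P : {poly {poly C}}).
Implicit Types (f g : H) (p q : {poly {poly C}}).

Lemma of_polyD p q : of_poly (p + q) = of_poly p + of_poly q.
Proof. by apply/funext => x; rewrite /of_poly !coefD. Qed.

Lemma of_polyN p : of_poly (- p) = - of_poly p.
Proof. by apply/funext => x; rewrite /of_poly !coefN. Qed.

Lemma of_poly0 : of_poly (0 : {poly {poly C}}) = 0.
Proof. by apply/funext => x; rewrite /of_poly !coef0. Qed.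

Lemma of_poly_sum (I : Type) (r : seq I) (F : I -> {poly {poly C}}) :
  of_poly (\sum_(i <- r) F i) = \sum_(i <- r) of_poly (F i).
Proof. exact: (big_morph _ of_polyD of_poly0). Qed.

Lemma of_polyZ (c : C) p : of_poly (c%:P%:P * p) = c *: of_poly p.
Proof. by apply/funext => x; rewrite /of_poly !coefCM. Qed.

Lemma hardy2_of_poly p : hardy2 (of_poly p).
Proof.
apply: (@hardy2_fin _ _ (size p + \max_(i < size p) size (p`_i)%R)%N) => a b ab.
rewrite /of_poly /=; have [pa|ap] := leqP (size p) a.
  by rewrite (nth_default 0 pa) coef0.
rewrite nth_default//.
have pb := @leq_bigmax _ (fun i : 'I_(size p) => size p`_i) (Ordinal ap).
case/orP: ab => [|ab]; first by rewrite leqNgt ltn_addr.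
exact: leq_trans pb (leq_trans (leq_addl _ _) ab).
Qed.

Lemma of_poly_monomial a b : of_poly (z ^+ a * w ^+ b) = delta R (a, b).
Proof.
apply/funext => -[c d]; rewrite /of_poly /delta /= -polyC_exp coefMC !coefXn.
rewrite xpair_eqE; have [_|_] := eqVneq c a; last by rewrite mul0r coef0.
by rewrite mul1r coefXn.
Qed.

Lemma poly_sum_monomial q :
  q = \sum_(a < size q) \sum_(b < size q`_a) (q`_a`_b)%:P%:P * (z ^+ a * w ^+ b).
Proof.
rewrite {1}[q in LHS](_ : q = \sum_(a < size q) q`_a *: z ^+ a).
  apply: eq_bigr => a _; rewrite -mul_polyC.
  rewrite {1}[q`_a](_ : _ = \sum_(b < size q`_a) (q`_a`_b)%:P * 'X^b).
    rewrite rmorph_sum mulr_suml; apply: eq_bigr => b _.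
    by rewrite /= rmorphM /= polyC_exp -mulrA [z ^+ a * _]mulrC.
  by rewrite -[LHS]coefK poly_def; apply: eq_bigr => b _; rewrite mul_polyC.
by rewrite -[LHS]coefK poly_def.
Qed.

Lemma of_poly_mul p q : of_poly (p * q) =
  \sum_(a < size q) \sum_(b < size q`_a)
     q`_a`_b *: of_poly (p * z ^+ a * w ^+ b).
Proof.
rewrite {1}(poly_sum_monomial q) mulr_sumr of_poly_sum; apply: eq_bigr => a _.
rewrite mulr_sumr of_poly_sum; apply: eq_bigr => b _.
by rewrite -of_polyZ; congr of_poly; ring.
Qed.

(** A bounded linear functional that kills the generators kills p C[z,w], hence its closure. It is
    applied to chain sums and to the difference of the two sides of the adjoint identity. *)
Lemma submodule_functional_eq0 p (L : H -> C) (B : R) :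
  (forall c f g, hardy2 f -> hardy2 g -> L (c *: f + g) = c * L f + L g) ->
  (forall f, hardy2 f -> sqn (L f) <= B * nrm f) ->
  (forall a b, L (of_poly (p * z ^+ a * w ^+ b)) = 0) ->
  forall f, submodule_gen p f -> L f = 0.
Proof.
move=> Llin LB Lp f [hf fap].
have L0 : L 0 = 0.
  have := Llin (-1) 0 0 (hardy20 R) (hardy20 R).
  by rewrite scaler0 addr0 mulN1r addNr.
have Lsum (I : Type) (r : seq I) (F : I -> H) :
    (forall i, hardy2 (F i)) -> (forall i, L (F i) = 0) -> L (\sum_(i <- r) F i) = 0.
  move=> hF LF; elim: r => [|i r IHr]; first by rewrite big_nil.
  rewrite big_cons -[F i]scale1r Llin ?IHr// ?LF ?mulr0 ?addr0//.
  exact: hardy2_sum.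
have Lpq q : L (of_poly (p * q)) = 0.
  have hm a b c : hardy2 (c *: of_poly (p * z ^+ a * w ^+ b)).
    exact/hardy2Z/hardy2_of_poly.
  rewrite of_poly_mul; apply: (Lsum) => [a|a]; first exact: hardy2_sum.
  apply: Lsum => // b; rewrite -[X in L X]addr0 Llin ?Lp ?L0 ?mulr0 ?addr0//.
    exact: hardy2_of_poly.
  exact: hardy20.
apply/eqP; rewrite -sqn_eq0 eq_le sqn_ge0 andbT; apply/ler_addgt0Pr => e e0.
(* [B] carries no sign, so the radius of approximation is taken relative to the positive bound
   [Num.max B 0 + 1]. *)
have B0 : 0 <= Num.max B 0 by rewrite le_max lexx orbT.
have [q] := fap (e / (Num.max B 0 + 1)) (divr_gt0 e0 (ltr_pwDr ltr01 B0)).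
have hd := hardy2B hf (hardy2_of_poly (p * q)).
rewrite nrmE// lte_fin => fq.
have -> : L f = L (f - of_poly (p * q)).
  rewrite -scaleN1r addrC Llin ?Lpq ?mulr0 ?add0r//; exact: hardy2_of_poly.
apply: le_trans (LB _ hd) _; rewrite add0r.
apply: (@le_trans _ _ (Num.max B 0 * (e / (Num.max B 0 + 1)))).
  apply: (@le_trans _ _ (Num.max B 0 * nrm (f - of_poly (p * q)))).
    by rewrite ler_wpM2r ?nrm_ge0// le_max lexx.
  by rewrite ler_wpM2l// ltW.
have B1 : 0 < Num.max B 0 + 1 by rewrite ltr_pwDr.
by rewrite mulrA ler_pdivrMr//; nra.
Qed.

End PolynomialSubmodules.

(** * Chains of monomials identified by z^k = w^k *)

Section Chains.
Variable R : realType.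
Local Notation C := R[i].
Local Notation H := (nat * nat -> C).
Local Notation z := ('X : {poly {poly C}}).
Local Notation w := ('X%:P : {poly {poly C}}).
Implicit Types (f g : H).
Variable k : nat.
Hypothesis k_gt0 : (0 < k)%N.
Local Notation M := (submodule_gen (zk_sub_wk R k)).

Lemma of_poly_mul_zk_sub_wk (q : {poly {poly C}}) a b :
  of_poly (zk_sub_wk R k * q) (a, b) =
  (if (k <= a)%N then q`_(a - k)`_b else 0) -
  (if (k <= b)%N then q`_a`_(b - k) else 0).
Proof.
rewrite /of_poly /zk_sub_wk mulrBl !coefB coefXnM -polyC_exp coefCM coefXnM /=.
by rewrite !ltnNge; case: leqP => _; case: leqP => _; rewrite ?coef0.
Qed.

Lemma of_poly_zk_sub_wk_monomial a b :
  of_poly (zk_sub_wk R k * z ^+ a * w ^+ b) =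
  delta R (a + k, b)%N - delta R (a, b + k)%N.
Proof.
rewrite -!of_poly_monomial -of_polyN -of_polyD; congr of_poly.
by rewrite /zk_sub_wk !exprD; ring.
Qed.

(* The relation z^k = w^k identifies the monomials z^(a + i k) w^(b - i k) of a
   chain; each chain is met once when [a < k] and [i <= b %/ k]. *)
Definition pt a b i : nat * nat := (a + i * k, b - i * k)%N.

Lemma divn_ge b : (k <= b)%N -> (b %/ k = ((b - k) %/ k).+1)%N.
Proof. by move=> kb; rewrite -{1}(subnK kb) divnDr ?divnn ?k_gt0 ?addn1. Qed.

(** From z^a w^b the chain extends a %/ k steps back and b %/ k steps forward, so the formula gives
    its length at each of its points, not only at its start. *)
Definition chain_size a b := (a %/ k + b %/ k).+1.

Lemma chain_size_start a b : (a < k)%N -> chain_size a b = (b %/ k).+1.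
Proof. by move=> ak; rewrite /chain_size divn_small. Qed.

Lemma leq_chain b i : (i <= b %/ k)%N = (i * k <= b)%N.
Proof. by rewrite leq_divRL. Qed.

Lemma pt_eq a b i a' b' i' : (a < k)%N -> (a' < k)%N ->
  (i <= b %/ k)%N -> (i' <= b' %/ k)%N ->
  (pt a b i == pt a' b' i') = [&& a == a', b == b' & i == i'].
Proof.
move=> ak ak'; rewrite !leq_chain => ib ib'.
apply/eqP/and3P => [[aa bb]|[/eqP-> /eqP-> /eqP->]//].
have ii : i = i'.
  have := congr1 (fun n => n %/ k)%N aa.
  by rewrite !(addnC _ (_ * k)%N) !divnMDl// !divn_small// !addn0.
by subst i'; split; apply/eqP; lia.
Qed.

Definition segment a b n : H := \sum_(i < n) delta R (pt a b i).

Lemma hardy2_segment a b n : hardy2 (segment a b n).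
Proof. by apply: hardy2_sum => i; exact: hardy2_delta. Qed.

Lemma inner_segment f a b n : hardy2 f ->
  inner f (segment a b n) = \sum_(i < n) f (pt a b i).
Proof.
move=> hf; rewrite innerC//; last exact: hardy2_segment.
rewrite inner_suml//; last by move=> i; exact: hardy2_delta.
rewrite conjc_sum; apply: eq_bigr => i _.
by rewrite -innerC ?inner_delta//; exact: hardy2_delta.
Qed.

Lemma segment_pt a b n a' b' i : (a < k)%N -> (a' < k)%N ->
  (n <= (b %/ k).+1)%N -> (i <= b' %/ k)%N ->
  segment a b n (pt a' b' i) = ((a == a') && (b == b') && (i < n)%N)%:R.
Proof.
move=> ak ak' nb ib; rewrite /segment fct_sumE.
have E (j : 'I_n) : delta R (pt a b j) (pt a' b' i) =
    ((a == a') && (b == b') && (val j == i))%:R.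
  rewrite /delta eq_sym pt_eq//; last by have := ltn_ord j; lia.
  by rewrite andbA.
rewrite (eq_bigr _ (fun j _ => E j)).
have [/andP[_ _]|_] := boolP ((a == a') && (b == b')); last first.
  by rewrite big1.
have [iln|nli] := ltnP i n.
  rewrite (bigD1 (Ordinal iln))//= eqxx big1 ?addr0// => j.
  by rewrite -val_eqE /= => /negbTE ->.
by apply: big1 => j _; rewrite (ltn_eqF (leq_trans (ltn_ord j) nli)).
Qed.

Definition chain_null : set H := [set f | hardy2 f /\
  forall a b, (a < k)%N -> \sum_(i < chain_size a b) f (pt a b i) = 0].

(** Along a chain the coefficients of (z^k - w^k) q are consecutive differences of coefficients of
    q, so their sum telescopes. *)
Lemma chain_null_of_poly q a b : (a < k)%N ->
  \sum_(i < chain_size a b) of_poly (zk_sub_wk R k * q) (pt a b i) = 0.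
Proof.
move=> ak; rewrite chain_size_start//.
(* The coefficient of q attached to the edge between the points i - 1 and i of the chain, extended
   by 0 so that both ends of the telescope vanish. *)
pose u i := if (0 < i <= b %/ k)%N then q`_(a + i.-1 * k)`_(b - i * k) else 0.
rewrite (eq_bigr (fun i : 'I__ => - (u i.+1 - u i))).
  rewrite sumrN -(big_mkord xpredT (fun i => u i.+1 - u i)) telescope_sumr//.
  by rewrite /u ltnn andbF subrr oppr0.
move=> [i /= ib] _; rewrite opprB of_poly_mul_zk_sub_wk; congr (_ - _).
  rewrite /u; case: i ib => [|i] ib /=; first by rewrite addn0 leqNgt ak.
  move: ib; rewrite ltnS => ib; rewrite ib (_ : (k <= _)%N = true) ?mulSn; last by lia.
  by rewrite (_ : (a + (k + i * k) - k)%N = (a + i * k)%N)//; lia.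
rewrite /u /= leq_chain.
have ibk : (i * k <= b)%N by rewrite -leq_chain -ltnS.
have -> : (k <= b - i * k)%N = (i.+1 * k <= b)%N by rewrite mulSn; lia.
by case: ifP => // _; rewrite (_ : (b - i * k - k)%N = (b - i.+1 * k)%N)// mulSn; lia.
Qed.

Lemma submodule_chain_null f : M f -> chain_null f.
Proof.
move=> Mf; have [hf _] := Mf; split=> // a b ak.
rewrite -inner_segment//.
have hs := hardy2_segment a b (chain_size a b).
apply: (@submodule_functional_eq0 R (zk_sub_wk R k) (fun f => inner f _)
  (nrm (segment a b (chain_size a b)))) Mf.
- by move=> c g h hg hh; rewrite innerDl ?innerZl//; exact: hardy2Z.
- by move=> g hg; rewrite mulrC cauchy_schwarz.
- move=> c d; rewrite inner_segment; last exact: hardy2_of_poly.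
  by rewrite -mulrA chain_null_of_poly.
Qed.

(** The cut is by total degree because a chain lies in a single degree: truncation keeps or removes
    whole chains and preserves vanishing chain sums. *)
Definition degree_trunc f N : H := fun x => if (x.1 + x.2 < N)%N then f x else 0.

Lemma hardy2_degree_trunc f N : hardy2 (degree_trunc f N).
Proof.
apply: (@hardy2_fin _ _ N) => a b ab; rewrite /degree_trunc /=.
by case: ltnP => //; lia.
Qed.

Lemma nrm_sub_degree_trunc f N : hardy2 f ->
  nrm (f - degree_trunc f N) = nrm f - nrm (degree_trunc f N).
Proof.
move=> hf; have ht := hardy2_degree_trunc f N; have hB := hardy2B hf ht.
have : inner (degree_trunc f N) (f - degree_trunc f N) = 0.
  rewrite (@inner_fin _ _ _ 0) ?/inner_partial ?big_ord0// => a b _.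
  rewrite -[(f - _) _]/(f (a, b) - degree_trunc f N (a, b)) /degree_trunc /=.
  by case: ifP => _; rewrite ?subrr ?conjc0 ?mulr0 ?mul0r.
move=> i0; have := nrmD ht hB; rewrite i0 /= mulr0 addr0 addrC subrK => ->.
by rewrite addrAC subrr add0r.
Qed.

Lemma degree_trunc_approx f (e : R) : hardy2 f -> 0 < e ->
  exists N, nrm (f - degree_trunc f N) < e.
Proof.
move=> hf e0; have /cvgrPdist_lt/(_ _ e0) := normsq_partial_cvg hf.
move=> [n _ /(_ n (leqnn n))] /=; rewrite ger0_norm ?subr_ge0 ?normsq_partial_le_nrm//.
(* The square [0, n)^2 consists of exponents of total degree below 2n. *)
move=> ne; exists n.*2; rewrite nrm_sub_degree_trunc//; apply: le_lt_trans ne.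
rewrite lerD2l lerN2; apply: le_trans (normsq_partial_le_nrm n (hardy2_degree_trunc f _)).
rewrite le_eqVlt; apply/orP; left; apply/eqP; apply: eq_bigr => a _; apply: eq_bigr => b _.
by rewrite /degree_trunc /= ifT//; have := ltn_ord a; have := ltn_ord b; lia.
Qed.

(** Division by z^k - w^k amounts to solving q(a - k, b) - q(a, b - k) = f(a, b) along each chain,
    and a vanishing chain sum is the condition for the solution to fit at the start of the chain. *)
Lemma chain_null_degree_trunc f N : chain_null f ->
  exists q, degree_trunc f N = of_poly (zk_sub_wk R k * q).
Proof.
move=> [_ f0].
(* The tail of the chain from the point (a + k, b) on; consecutive tails differ by one value of
   f. *)
pose c a b : C := if (a + b + k < N)%N
  then \sum_(i < (b %/ k).+1) f (a + k + i * k, b - i * k)%N else 0.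
pose q : {poly {poly C}} := \poly_(a < N) \poly_(b < N) c a b.
have qE a b : q`_a`_b = c a b.
  rewrite coef_poly; case: ltnP => [aN|Na]; last first.
    by rewrite coef0 /c; case: ltnP => //; lia.
  rewrite coef_poly; case: ltnP => // Nb.
  by rewrite /c; case: ltnP => //; lia.
exists q; apply/funext => -[a b]; rewrite of_poly_mul_zk_sub_wk !qE.
rewrite /degree_trunc /= /c.
have [ka|ak] := leqP k a.
  have -> : (a - k + b + k = a + b)%N by lia.
  have [kb|bk] := leqP k b.
    have -> : (a + (b - k) + k = a + b)%N by lia.
    case: ifP => _; last by rewrite subrr.
    have -> : (b %/ k = ((b - k) %/ k).+1)%N := divn_ge kb.
    rewrite big_ord_recl /= mul0n addn0 subn0 subnK//.
    rewrite [X in _ + X - _](_ : _ = \sum_(i < ((b - k) %/ k).+1)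
      f (a + k + i * k, b - k - i * k)%N) ?addrK//.
    by apply: eq_bigr => i _; congr (f (_, _)); rewrite /bump /= mulnDl mul1n; lia.
  rewrite divn_small// big_ord1 /= mul0n addn0 subn0 subnK// subr0.
  by case: ifP.
have [kb|bk] := leqP k b; last first.
  rewrite subrr; case: ifP => // _.
  by have := f0 a b ak; rewrite chain_size_start// divn_small// big_ord1 /pt mul0n addn0 subn0.
have -> : (a + (b - k) + k = a + b)%N by lia.
rewrite sub0r; case: ifP => _; last by rewrite oppr0.
have := f0 a b ak; rewrite chain_size_start// big_ord_recl /pt mul0n addn0 subn0.
move=> /eqP; rewrite addr_eq0 => /eqP ->; congr (- _).
have -> : (b %/ k = ((b - k) %/ k).+1)%N := divn_ge kb.
by apply: eq_bigr => i _; congr (f (_, _)); rewrite /bump /= mulnDl mul1n; lia.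
Qed.

Lemma chain_null_submodule f : chain_null f -> M f.
Proof.
move=> nf; have [hf _] := nf; split=> // e e0.
have [N fN] := degree_trunc_approx hf e0.
have [q qE] := chain_null_degree_trunc N nf.
by exists q; rewrite -qE nrmE ?lte_fin//; apply: hardy2B => //; exact: hardy2_degree_trunc.
Qed.

End Chains.

(** * Reproducing kernels and an orthonormal basis of M *)

Section Basis.
Variable R : realType.
Local Notation C := R[i].
Local Notation H := (nat * nat -> C).
Local Notation z := ('X : {poly {poly C}}).
Local Notation w := ('X%:P : {poly {poly C}}).
Implicit Types (f g : H).
Variable k : nat.
Hypothesis k_gt0 : (0 < k)%N.
Local Notation M := (submodule_gen (zk_sub_wk R k)).
Local Notation pt := (pt k).
Local Notation segment := (segment R k).

Lemma sum_ltn (n m : nat) : (m <= n)%N -> \sum_(i < n) ((val i < m)%N%:R : C) = m%:R.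
Proof.
move=> mn; rewrite -(big_mkord xpredT (fun i => (i < m)%N%:R : C)).
rewrite (big_cat_nat (leq0n m) mn)/= [X in _ + X]big_nat_cond [X in _ + X]big1 ?addr0; last first.
  by move=> i /andP[/andP[mi _] _]; rewrite ltnNge mi.
rewrite big_nat_cond (eq_bigr (fun=> 1)); last by move=> i /andP[/andP[_ ->]].
by rewrite -big_nat_cond sumr_const_nat subn0.
Qed.

Lemma sum_segment a b n a' b' : (a < k)%N -> (a' < k)%N ->
  (n <= (b %/ k).+1)%N ->
  \sum_(i < chain_size k a' b') segment a b n (pt a' b' i) =
  ((a == a') && (b == b'))%:R * n%:R.
Proof.
move=> ak ak' nb; rewrite chain_size_start//.
rewrite (eq_bigr (fun i : 'I__ => ((a == a') && (b == b'))%:R * (val i < n)%N%:R)).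
  rewrite -mulr_sumr; have [/andP[_ /eqP <-]|_] := boolP (_ && _); last by rewrite !mul0r.
  by rewrite sum_ltn.
move=> i _; have ib : (i <= b' %/ k)%N by rewrite -ltnS.
by rewrite segment_pt// -natrM mulnb.
Qed.

Lemma delta_segment a b i : delta R (pt a b i) = segment a b i.+1 - segment a b i.
Proof. by rewrite /segment big_ord_recr /= addrAC subrr add0r. Qed.

Definition kernel n : H :=
  delta R (0%N, n) - ((chain_size k 0 n)%:R^-1 : C) *: segment 0 n (chain_size k 0 n).

Lemma hardy2_kernel n : hardy2 (kernel n).
Proof.
by apply: hardy2B; [exact: hardy2_delta|exact/hardy2Z/hardy2_segment].
Qed.

Lemma delta0 n : delta R (0%N, n) = segment 0 n 1.
Proof. by rewrite /segment big_ord1 /pt /= mul0n add0n subn0. Qed.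

Lemma kernel_submodule n : M (kernel n).
Proof.
apply: chain_null_submodule => //; split=> [|a b ak]; first exact: hardy2_kernel.
rewrite /kernel delta0 sumrB sum_segment//=.
rewrite -(mulr_sumr _ (fun=> true)) sum_segment//= ?chain_size_start//.
by rewrite mulrCA mulVf ?subrr// pnatr_eq0.
Qed.

Lemma inner_kernel f n : M f -> inner f (kernel n) = f (0%N, n).
Proof.
move=> Mf; have [hf f0] := submodule_chain_null k_gt0 Mf.
have hs := hardy2_segment R k 0 n (chain_size k 0 n).
rewrite innerBr ?innerZr//; [|exact: hardy2_delta|exact: hardy2Z].
by rewrite inner_delta inner_segment// f0// mulr0 subr0.
Qed.

(** By the reproducing property, the squared norm is the kernel's own coefficient at (0, n). *)
Lemma nrm_kernel n : nrm (kernel n) = 1 - (chain_size k 0 n)%:R^-1.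
Proof.
have : ((nrm (kernel n))%:C)%C = ((1 - (chain_size k 0 n)%:R^-1)%:C)%C.
  rewrite -innerff; last exact: hardy2_kernel.
  rewrite inner_kernel; last exact: kernel_submodule.
  have p0 : (0%N, n) = pt 0 n 0 by rewrite /pt mul0n subn0.
  rewrite -[kernel n _]/(delta R (0%N, n) (0%N, n) -
    (chain_size k 0 n)%:R^-1 * segment 0 n (chain_size k 0 n) (0%N, n)).
  rewrite {3}p0 segment_pt//= ?chain_size_start// /delta !eqxx mulr1.
  by rewrite rmorphB fmorphV rmorph1 rmorph_nat.
by case.
Qed.

(* On each chain these are, up to scaling, Helmert's orthogonal basis
   (1, ..., 1, -m, 0, ..., 0) of the vectors with zero sum. *)
Definition helmert a b m : H := segment a b m - m%:R *: delta R (pt a b m).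

Lemma hardy2_helmert a b m : hardy2 (helmert a b m).
Proof.
by apply: hardy2B; [exact: hardy2_segment|exact/hardy2Z/hardy2_delta].
Qed.

Lemma helmert_pt a b m a' b' i : (a < k)%N -> (a' < k)%N ->
  (m <= b %/ k)%N -> (i <= b' %/ k)%N ->
  helmert a b m (pt a' b' i) = ((a == a') && (b == b'))%:R *
    ((i < m)%N%:R - m%:R * (i == m)%:R).
Proof.
move=> ak ak' mb ib.
rewrite -[helmert _ _ _ _]/(segment a b m (pt a' b' i) -
  m%:R * delta R (pt a b m) (pt a' b' i)).
rewrite segment_pt ?leqW// /delta [pt a' b' i == _]eq_sym pt_eq// andbA [m == i]eq_sym.
by case: ((a == a') && (b == b')); rewrite /= ?mul1r// mul0r mulr0 subrr.
Qed.

Lemma sum_helmert (m n : nat) :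
  \sum_(i < n) ((val i < m)%N%:R - m%:R * (val i == m)%:R : C) =
  if (n <= m)%N then n%:R else 0.
Proof.
elim: n => [|n IHn]; first by rewrite big_ord0.
rewrite big_ord_recr /= IHn; have [nm|mn|->] := ltngtP n m.
- by rewrite mulr0 subr0 natr1.
- by rewrite mulr0 subr0 addr0.
- by rewrite mulr1 add0r subrr.
Qed.

Lemma helmert_submodule a b m : (a < k)%N -> (m <= b %/ k)%N ->
  M (helmert a b m).
Proof.
move=> ak mb; apply: chain_null_submodule => //; split=> [|a' b' ak'].
  exact: hardy2_helmert.
rewrite chain_size_start// (eq_bigr (fun i : 'I__ => ((a == a') && (b == b'))%:R *
    ((val i < m)%N%:R - m%:R * (val i == m)%:R : C))).
  rewrite -mulr_sumr sum_helmert; have [/andP[_ /eqP <-]|_] := boolP (_ && _).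
    by rewrite leqNgt ltnS mb mulr0.
  by rewrite mul0r.
move=> i _; have ib : (i <= b' %/ k)%N by rewrite -ltnS.
by rewrite helmert_pt.
Qed.

(** On one chain, the vector with the larger index is constant on the support of the other, whose
    sum vanishes. The squared norm is m + m^2. *)
Lemma inner_helmert a b m a' b' m' : (a < k)%N -> (a' < k)%N ->
  (m <= b %/ k)%N -> (m' <= b' %/ k)%N ->
  inner (helmert a b m) (helmert a' b' m') =
  ([&& a == a', b == b' & m == m'])%:R * (m * m.+1)%:R.
Proof.
move=> ak ak' mb mb'.
have hh := hardy2_helmert a b m; have hd := hardy2_delta R (pt a' b' m').
have hs := hardy2_segment R k a' b' m'.
rewrite -[helmert a' b' m']/(segment a' b' m' - m'%:R *: delta R (pt a' b' m')).
rewrite innerBr//; last exact: hardy2Z.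
rewrite innerZr// inner_segment// inner_delta helmert_pt//.
rewrite (eq_bigr (fun i : 'I_m' => ((a == a') && (b == b'))%:R *
    ((val i < m)%N%:R - m%:R * (val i == m)%:R : C))); last first.
  by move=> i _; rewrite helmert_pt//; have := ltn_ord i; lia.
rewrite -mulr_sumr sum_helmert conjc_nat andbA.
case: (_ && _); last by rewrite /= !mul0r mulr0 subrr.
rewrite /= !mul1r eq_sym; have [mm|mm|->] := ltngtP m m'.
- by rewrite mulr0 subrr mulr0 subrr mul0r.
- by rewrite mulr0 subr0 mulr1 subrr mul0r.
- by rewrite natrM -natr1 /=; ring.
Qed.

(** The vector [helmert a b 0] is zero, hence the bound [0 < m]. *)
Definition helmert_basis : set H := [set v | exists a b m,
  [/\ (a < k)%N, (0 < m <= b %/ k)%N &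
   v = (((Num.sqrt (m * m.+1)%:R)^-1 : R)%:C)%C *: helmert a b m]].

Definition spanned (E : set H) f := exists n (c : 'I_n -> C) (e : 'I_n -> H),
  (forall i, E (e i)) /\ f = \sum_(i < n) c i *: e i.

Lemma spanned0 E : spanned E 0.
Proof.
by exists 0%N, (fun=> 0), (fun=> 0); split => [[]//|]; rewrite big_ord0.
Qed.

Lemma spannedD E f g : spanned E f -> spanned E g -> spanned E (f + g).
Proof.
move=> [n [c [e [Ee ->]]]] [n' [c' [e' [Ee' ->]]]].
exists (n + n')%N,
  (fun i => match fintype.split i with inl j => c j | inr j => c' j end),
  (fun i => match fintype.split i with inl j => e j | inr j => e' j end).
split=> [i|]; first by case: (fintype.split i).
rewrite big_split_ord /=; congr (_ + _); apply: eq_bigr => i _.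
  by rewrite (unsplitK (inl i)).
by rewrite (unsplitK (inr i)).
Qed.

Lemma spannedZ E c f : spanned E f -> spanned E (c *: f).
Proof.
move=> [n [d [e [Ee ->]]]]; exists n, (fun i => c * d i), e; split => //.
by rewrite scaler_sumr; apply: eq_bigr => i _; rewrite scalerA.
Qed.

Lemma spanned_sum E (I : Type) (r : seq I) (F : I -> H) :
  (forall i, spanned E (F i)) -> spanned E (\sum_(i <- r) F i).
Proof. by move=> EF; elim/big_ind: _ => // *; [exact: spanned0|exact: spannedD]. Qed.

Lemma spanned_helmert a b m : (a < k)%N -> (m <= b %/ k)%N ->
  spanned helmert_basis (helmert a b m).
Proof.
move=> ak mb; have [->|m0] := eqVneq m 0%N.
  by rewrite /helmert /segment big_ord0 scale0r subr0; exact: spanned0.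
exists 1%N, (fun=> ((Num.sqrt (m * m.+1)%:R : R)%:C)%C),
  (fun=> (((Num.sqrt (m * m.+1)%:R)^-1 : R)%:C)%C *: helmert a b m); split.
  by move=> _; exists a, b, m; rewrite lt0n m0 mb.
rewrite big_ord1 scalerA -real_complexM mulfV ?scale1r//.
by rewrite sqrtr_eq0 -ltNge ltr0n muln_gt0 lt0n m0.
Qed.

(** A generator is the difference of two neighbours on a chain, and the difference of two
    consecutive Helmert vectors is m + 1 times such a difference. *)
Lemma spanned_monomial a b :
  spanned helmert_basis (of_poly (zk_sub_wk R k * z ^+ a * w ^+ b)).
Proof.
rewrite of_poly_zk_sub_wk_monomial.
(* The chain starts at (a0, b0), and the two monomials of the generator are its points m + 1 and
   m. *)
pose m := (a %/ k)%N; pose a0 := (a %% k)%N; pose b0 := (b + m.+1 * k)%N.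
have a0k : (a0 < k)%N by rewrite ltn_mod.
have mb : (m.+1 <= b0 %/ k)%N by rewrite leq_divRL// leq_addl.
have am : a = (a0 + m * k)%N by rewrite /a0 /m addnC -divn_eq.
have -> : (a + k, b)%N = pt a0 b0 m.+1 by rewrite /pt /b0 addnK mulSn; congr pair; lia.
have -> : (a, b + k)%N = pt a0 b0 m by rewrite /pt /b0 mulSn -am; congr pair; lia.
have -> : delta R (pt a0 b0 m.+1) - delta R (pt a0 b0 m) =
    m.+1%:R^-1 *: (helmert a0 b0 m + (-1) *: helmert a0 b0 m.+1).
  have n0 : (m.+1%:R : C) != 0 by rewrite pnatr_eq0.
  have hd : helmert a0 b0 m + -1 *: helmert a0 b0 m.+1 =
      (m.+1%:R : C) *: (delta R (pt a0 b0 m.+1) - delta R (pt a0 b0 m)).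
    rewrite scaleN1r /helmert (_ : segment a0 b0 m.+1 = segment a0 b0 m + delta R (pt a0 b0 m)).
      apply/funext => x; set s := segment a0 b0 m.
      set d0 := delta R (pt a0 b0 m); set d1 := delta R (pt a0 b0 m.+1).
      rewrite -[LHS]/(s x - m%:R * d0 x - (s x + d0 x - m.+1%:R * d1 x)).
      by rewrite -[RHS]/(m.+1%:R * (d1 x - d0 x)) -natr1; ring.
    by rewrite delta_segment addrC subrK.
  by rewrite hd scalerA mulVf// scale1r.
apply/spannedZ/spannedD; last apply: spannedZ; apply: spanned_helmert => //.
exact: ltnW.
Qed.

Lemma helmert_orthonormal_basis : orthonormal_basis M helmert_basis.
Proof.
split.
- move=> _ [a [b [m [ak /andP[m0 mb] ->]]]].
  have [hv v0] := submodule_chain_null k_gt0 (helmert_submodule ak mb).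
  apply: chain_null_submodule => //; split=> [|a' b' ak']; first exact: hardy2Z.
  by rewrite -(mulr_sumr _ (fun=> true)) v0// mulr0.
- move=> _ [a [b [m [ak /andP[m0 mb] ->]]]].
  have hh := hardy2_helmert a b m.
  rewrite innerZl ?innerZr//; last exact: hardy2Z.
  rewrite mulrA mulcJ inner_helmert// !eqxx mul1r sqn_real exprVn sqr_sqrtr ?ler0n//.
  by rewrite fmorphV rmorph_nat mulVf// pnatr_eq0 -lt0n muln_gt0 m0.
- move=> _ _ [a [b [m [ak /andP[m0 mb] ->]]]] [a' [b' [m' [ak' /andP[m0' mb'] ->]]]] ne.
  have hh := hardy2_helmert a b m; have hh' := hardy2_helmert a' b' m'.
  rewrite innerZl ?innerZr//; last exact: hardy2Z.
  rewrite inner_helmert//; case: and3P => [[/eqP ? /eqP ? /eqP ?]|_]; first by subst.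
  by rewrite mul0r !mulr0.
- move=> f [hf fap] e e0; have [q fq] := fap e e0.
  suff [n [c [v [Ev qE]]]] : spanned helmert_basis (of_poly (zk_sub_wk R k * q)).
    by exists n, c, v; rewrite -qE.
  rewrite of_poly_mul; apply: spanned_sum => a; apply: spanned_sum => b.
  exact/spannedZ/spanned_monomial.
Qed.

End Basis.

(** * Adjoints of the coordinate multiplications *)

Section Adjoints.
Variable R : realType.
Local Notation C := R[i].
Local Notation H := (nat * nat -> C).
Local Notation z := ('X : {poly {poly C}}).
Local Notation w := ('X%:P : {poly {poly C}}).
Implicit Types (f g : H).

Lemma normsq_mulz f : normsq (mulz f) = normsq f.
Proof.
pose F x := (sqn (mulz f x))%:E.
transitivity (\esum_(x in [set: nat * nat]) F (x.1.+1, x.2))%E.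
  rewrite esum_shift1// => [x|b]; first by rewrite lee_fin sqn_ge0.
  by rewrite /F sqn0.
by apply: eq_esum => -[].
Qed.

Lemma hardy2_mulz f : hardy2 f -> hardy2 (mulz f).
Proof. by rewrite /hardy2 /= normsq_mulz. Qed.

Lemma nrm_mulz f : nrm (mulz f) = nrm f.
Proof. by rewrite /nrm normsq_mulz. Qed.

Lemma mulz_linear c f g : mulz (c *: f + g) = c *: mulz f + mulz g.
Proof.
apply/funext => -[[|a] b] //.
by rewrite -[RHS]/(c * 0 + 0) mulr0 addr0.
Qed.

(** Since z^k - w^k is antisymmetric in z and w, M is stable under this exchange, and statements
    about w follow from those about z. *)
Definition swap f : H := fun x => f (x.2, x.1).

Lemma mulwE f : mulw f = swap (mulz (swap f)).
Proof. by apply/funext => -[a [|b]]. Qed.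

Lemma swapK f : swap (swap f) = f.
Proof. by apply/funext => -[]. Qed.

Lemma hardy2_swap f : hardy2 f -> hardy2 (swap f).
Proof.
move=> hf; apply: (@hardy2_bound _ _ (nrm f)) => N.
rewrite /normsq_partial exchange_big; exact: normsq_partial_le_nrm.
Qed.

Lemma inner_swap f g : inner (swap f) (swap g) = inner f g.
Proof.
suff E : inner_partial (swap f) (swap g) = inner_partial f g by rewrite /inner E.
by apply/funext => N; rewrite /inner_partial exchange_big.
Qed.

(** Two candidates differ by an element of M orthogonal to M, hence to itself; the given [h]
    supplies existence. *)
Lemma adj_eq (M : set H) (T : H -> H) g h : M `<=` @hardy2 R ->
  (forall f f', M f -> M f' -> M (f - f')) ->
  M h -> (forall f, M f -> inner (T f) g = inner f h) -> adj M T g = h.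
Proof.
move=> Mh MB Mhh hT; rewrite /adj; apply: xget_unique; first by [].
move=> h' [Mh' hT']; have Md := MB _ _ Mh' Mhh; have hd := Mh _ Md.
have : inner (h' - h) (h' - h) = 0.
  have [hh hh'] := (Mh _ Mhh, Mh _ Mh').
  by rewrite innerBr// -hT// -hT'// subrr.
rewrite innerff// => -[/(nrm0_eq0 hd) d0]; apply/eqP.
by rewrite -subr_eq0 d0.
Qed.

Lemma inner_mulz_adj p g h : hardy2 g -> hardy2 h ->
  (forall a b, inner (mulz (of_poly (p * z ^+ a * w ^+ b))) g =
     inner (of_poly (p * z ^+ a * w ^+ b)) h) ->
  forall f, submodule_gen p f -> inner (mulz f) g = inner f h.
Proof.
move=> hg hh gh f Mf; apply/eqP; rewrite -subr_eq0; apply/eqP.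
apply: (@submodule_functional_eq0 R p (fun f => inner (mulz f) g - inner f h)
  (2 * nrm g + 2 * nrm h)) Mf.
- move=> c f1 f2 h1 h2; rewrite mulz_linear.
  have h1' := hardy2_mulz h1; have h2' := hardy2_mulz h2.
  rewrite !innerDl ?innerZl//; do ?exact: hardy2Z.
  ring.
- move=> f1 h1; apply: le_trans (sqnD_le _ _) _; rewrite sqnN mulrDl.
  have h1' := hardy2_mulz h1.
  have := cauchy_schwarz h1' hg; have := cauchy_schwarz h1 hh.
  by rewrite nrm_mulz => ? ?; nra.
- by move=> a b; rewrite gh subrr.
Qed.

Variable k : nat.
Hypothesis k_gt0 : (0 < k)%N.
Local Notation M := (submodule_gen (zk_sub_wk R k)).
Local Notation pt := (pt k).

Lemma submodule_hardy2 : M `<=` @hardy2 R.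
Proof. by move=> f []. Qed.

Lemma submoduleB f g : M f -> M g -> M (f - g).
Proof.
move=> /(submodule_chain_null k_gt0)[hf f0] /(submodule_chain_null k_gt0)[hg g0].
apply: chain_null_submodule => //; split=> [|a b ak]; first exact: hardy2B.
by rewrite sumrB f0// g0// subrr.
Qed.

Lemma chain_size_pt a b i : (i <= b %/ k)%N ->
  chain_size k (a + i * k) (b - i * k) = chain_size k a b.
Proof.
move=> ib; have ibk : (i * k <= b)%N by rewrite -leq_divRL.
by rewrite /chain_size divnDMl// -{2}(subnK ibk) divnDMl//; lia.
Qed.

Lemma chain_size_shift a b : chain_size k (a + k) b = chain_size k a (b + k).
Proof. by rewrite /chain_size -{1}[k]mul1n -[X in (b + X)%N]mul1n !divnDMl//; lia. Qed.

(* The projection onto M subtracts the mean over each chain.  After the backward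
   shift only the chains starting at a = k - 1 have a nonzero sum, namely minus
   the lost coefficient [g (0, a + b + 1)]. *)
Definition adjz g : H := fun x => g (x.1.+1, x.2) +
  if (k %| x.1.+1)%N then (chain_size k x.1 x.2)%:R^-1 * g (0, x.1 + x.2.+1)%N else 0.

Lemma chain_size_large a b : (a + b + 1 <= k.*2 * chain_size k a b)%N.
Proof.
have := ltn_ceil a k_gt0; have := ltn_ceil b k_gt0; rewrite /chain_size.
by move: (a %/ k)%N (b %/ k)%N => p q; nia.
Qed.

(** Chain lengths L grow linearly with the degree: L^-2 <= L^-1 <= 2k/(n + 1) in degree n. The n + 1
    monomials of that degree therefore contribute at most 2k times the squared modulus of g(0, n +
    1). *)
Lemma hardy2_adjz_correction g : hardy2 g ->
  hardy2 (fun x : nat * nat => if (k %| x.1.+1)%N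
    then (chain_size k x.1 x.2)%:R^-1 * g (0, x.1 + x.2.+1)%N else 0).
Proof.
move=> hg; set e := fun x : nat * nat => _.
have eB a n : (a <= n)%N ->
    sqn (e (a, n - a)%N) <= sqn (g (0, n.+1)%N) * ((k.*2)%:R * n.+1%:R^-1).
  move=> an; rewrite /e /=; case: ifP => _; last first.
    by rewrite sqn0 mulr_ge0 ?sqn_ge0// mulr_ge0 ?invr_ge0.
  rewrite addnS subnKC// sqnM mulrC ler_wpM2l ?sqn_ge0// sqnV.
  have := chain_size_large a (n - a); rewrite subnKC// addn1.
  set L := chain_size k a (n - a) => nL.
  have -> : sqn (L%:R : C) = L%:R ^+ 2 by rewrite -(rmorph_nat (real_complex R)) sqn_real.
  have L1 : (1 : R) <= L%:R by rewrite ler1n.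
  have n1 : (0 : R) < n.+1%:R by rewrite ltr0n.
  have {}nL : n.+1%:R <= (k.*2)%:R * L%:R :> R by rewrite -natrM ler_nat.
  rewrite -[leLHS]mul1r ler_pdivrMr ?exprn_gt0 ?(lt_le_trans ltr01)//.
  rewrite mulrAC ler_pdivlMr// mul1r; apply: le_trans nL _.
  by rewrite ler_wpM2l// expr2 ler_peMl// (le_trans ler01).
rewrite /hardy2 /= /normsq esum_antidiagonal; last first.
  by move=> x; rewrite lee_fin sqr_ge0.
apply: (@le_lt_trans _ _ ((k.*2)%:R * nrm g)%:E); last by rewrite ltry.
apply: lime_le.
  by apply: is_cvg_nneseries => n _ _; apply: sume_ge0 => a _; rewrite lee_fin sqr_ge0.
apply: nearW => N; under eq_bigr do rewrite sumEFin; rewrite sumEFin lee_fin.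
apply: (@le_trans _ _ (\sum_(0 <= n < N) (k.*2)%:R * sqn (g (0, n.+1)%N))).
  apply: ler_sum => n _.
  apply: (@le_trans _ _ (\sum_(a < n.+1) sqn (g (0, n.+1)%N) * ((k.*2)%:R * n.+1%:R^-1))).
    by apply: ler_sum => a _; exact: (eB a n (ltn_ord a)).
  rewrite sumr_const card_ord -[leLHS]mulr_natr -(mulrA (sqn _)) divfK ?pnatr_eq0//.
  by rewrite mulrC.
rewrite -mulr_sumr ler_wpM2l//; apply: le_trans (normsq_partial_le_nrm N.+1 hg).
rewrite /normsq_partial big_ord_recl /= big_ord_recl /= big_mkord.
rewrite [leLHS](eq_bigr (fun i : 'I_N => sqn (g (0%N, bump 0 i)))) //.
rewrite -addrA addrCA lerDl addr_ge0 ?sqn_ge0//.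
by apply: sumr_ge0 => i _; apply: sumr_ge0 => j _; exact: sqn_ge0.
Qed.

Lemma hardy2_backward_shift g : hardy2 g -> hardy2 (fun x => g (x.1.+1, x.2)).
Proof.
move=> hg; apply: (@hardy2_bound _ _ (nrm g)) => N.
apply: le_trans (normsq_partial_le_nrm N.+1 hg).
rewrite /normsq_partial big_ord_recl /=.
rewrite [leRHS]addrC; apply: ler_wpDr.
  by apply: sumr_ge0 => j _; exact: sqn_ge0.
apply: ler_sum => a _; rewrite big_ord_recr /= lerDl; exact: sqn_ge0.
Qed.

Lemma hardy2_adjz g : hardy2 g -> hardy2 (adjz g).
Proof.
move=> hg; apply: hardy2D; first exact: hardy2_backward_shift.
exact: hardy2_adjz_correction.
Qed.

Lemma adjz_submodule g : M g -> M (adjz g).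
Proof.
move=> /(submodule_chain_null k_gt0)[hg g0].
apply: chain_null_submodule => //; split=> [|a b ak]; first exact: hardy2_adjz.
rewrite /adjz big_split /=.
have corr : \sum_(i < chain_size k a b) (if (k %| (a + i * k).+1)%N then
      (chain_size k (a + i * k) (b - i * k))%:R^-1 * g (0, a + i * k + (b - i * k).+1)%N else 0) =
    if (k %| a.+1)%N then g (0, a + b.+1)%N else 0.
  rewrite (eq_bigr (fun=> (chain_size k a b)%:R^-1 *
    if (k %| a.+1)%N then g (0, a + b.+1)%N else 0)).
    by rewrite sumr_const card_ord -[LHS]mulr_natl mulrA mulfV ?mul1r// pnatr_eq0.
  move=> i _; have ib : (i <= b %/ k)%N by rewrite -ltnS -(chain_size_start b ak).
  rewrite chain_size_pt// -addSn dvdn_addl ?dvdn_mull//.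
  have ibk : (i * k <= b)%N by rewrite -leq_divRL.
  have -> : (a + i * k + (b - i * k).+1 = a + b.+1)%N by lia.
  by case: ifP; rewrite ?mulr0.
rewrite corr; have [ak1|ka] := ltnP a.+1 k.
  rewrite gtnNdvd// addr0; have := g0 a.+1 b ak1.
  by rewrite chain_size_start// chain_size_start.
(* Here a + 1 = k: the shifted values are those of the chain starting at w^(b + k) without its first
   point, and the correction restores the coefficient of that point. *)
have {ka ak} -> : a = k.-1 by lia.
rewrite prednK// dvdnn; have := g0 0%N (b + k)%N k_gt0.
rewrite chain_size_start// (_ : (b + k) %/ k = (b %/ k).+1)%N; last first.
  by rewrite -{1}[k]mul1n divnDMl// addn1.
rewrite big_ord_recl /= {1}/pt mul0n subn0 addn0 chain_size_start ?prednK//.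
have -> : (k.-1 + b.+1 = b + k)%N by lia.
move=> h; rewrite addrC -[RHS]h; congr (_ + _); apply: eq_bigr => i _.
by rewrite /pt /bump /= mulnDl mul1n; congr (g (_, _)); lia.
Qed.

(** The correction is constant on chains, hence orthogonal to every generator, so only the plain
    backward shift has to be compared with [mulz]. *)
Lemma inner_adjz f g : M f -> M g -> inner (mulz f) g = inner f (adjz g).
Proof.
move=> Mf Mg; have hg := submodule_hardy2 Mg.
have ha := submodule_hardy2 (adjz_submodule Mg); move: f Mf.
apply: inner_mulz_adj => // a b.
rewrite of_poly_zk_sub_wk_monomial.
have md x : mulz (delta R x) = delta R (x.1.+1, x.2).
  by apply/funext => -[[|c] d]; case: x.
have -> : mulz (delta R (a + k, b)%N - delta R (a, b + k)%N) =
    delta R ((a + k).+1, b)%N - delta R (a.+1, b + k)%N.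
  by rewrite -scaleN1r addrC mulz_linear !md scaleN1r addrC.
have hd := hardy2_delta R.
rewrite !innerBl// !(@innerC _ (delta R _))// !inner_delta /adjz /=.
rewrite -addSn dvdn_addl// chain_size_shift.
have -> : (a + k + b.+1 = a + (b + k).+1)%N by lia.
by rewrite !conjcD; ring.
Qed.

Lemma adj_mulz g : M g -> adj M (@mulz R) g = adjz g.
Proof.
move=> Mg; apply: adj_eq; [exact: submodule_hardy2|exact: submoduleB
  |exact: adjz_submodule|by move=> f Mf; exact: inner_adjz].
Qed.

Lemma submodule_swap f : M f -> M (swap f).
Proof.
move=> /(submodule_chain_null k_gt0)[hf f0].
apply: chain_null_submodule => //; split=> [|a b ak]; first exact: hardy2_swap.
(* The exchange maps the chain starting at (a, b) to this chain, traversed backwards. *)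
have := f0 (b %% k)%N (a + b %/ k * k)%N (ltn_pmod _ k_gt0).
rewrite !chain_size_start ?ltn_mod// divnDMl// divn_small// add0n => h; rewrite -[RHS]h.
rewrite [LHS](reindex_inj rev_ord_inj) /=; apply: eq_bigr => i _.
have ib : (i <= b %/ k)%N by rewrite -ltnS.
have bE := divn_eq b k.
rewrite /swap /pt /= subSS mulnBl; congr (f (_, _)).
  have : (i * k <= b %/ k * k)%N by rewrite leq_mul2r ib orbT.
  by lia.
have : (i * k <= b %/ k * k)%N by rewrite leq_mul2r ib orbT.
by lia.
Qed.

Lemma adj_mulw g : M g -> adj M (@mulw R) g = swap (adjz (swap g)).
Proof.
move=> Mg; apply: adj_eq; [exact: submodule_hardy2|exact: submoduleB
  |exact/submodule_swap/adjz_submodule/submodule_swap|].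
move=> f Mf; rewrite mulwE -{1}(swapK g) inner_swap -{2}(swapK f) inner_swap.
by apply: inner_adjz; exact: submodule_swap.
Qed.

End Adjoints.

(** * The invariants of order zero and one *)

Section Sigma01.
Variable R : realType.
Local Notation C := R[i].
Local Notation H := (nat * nat -> C).
Local Notation z := ('X : {poly {poly C}}).
Implicit Types (f g : H).

Lemma sqn_nat n : sqn (n%:R : C) = n%:R ^+ 2.
Proof. by rewrite -(rmorph_nat (real_complex R)) sqn_real. Qed.

Lemma of_polyXM (p : {poly {poly C}}) : of_poly (z * p) = mulz (of_poly p).
Proof.
by apply/funext => -[[|a] b]; rewrite /of_poly /= coefXM //= coef0.
Qed.

Lemma mulzB f g : mulz (f - g) = mulz f - mulz g.
Proof. by have := mulz_linear (-1) g f; rewrite !scaleN1r ![- _ + _]addrC. Qed.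

Lemma submodule_mulz (p : {poly {poly C}}) f :
  submodule_gen p f -> submodule_gen p (mulz f).
Proof.
move=> [hf fap]; split; first exact: hardy2_mulz.
move=> e /fap[q fq]; exists (z * q).
by rewrite mulrCA of_polyXM -mulzB normsq_mulz.
Qed.

Variable k : nat.
Hypothesis k_gt0 : (0 < k)%N.
Local Notation M := (submodule_gen (zk_sub_wk R k)).
Local Notation kernel := (kernel R k).

Lemma submodule_mulw f : M f -> M (mulw f).
Proof.
by move=> Mf; rewrite mulwE; exact/(submodule_swap k_gt0)/submodule_mulz/submodule_swap.
Qed.

Lemma hs_normsq_weighted (T : H -> H) (c : nat * nat -> C) (d : nat * nat -> nat) :
  (forall f x, M f -> T f x = c x * f (0%N, d x)) ->
  (hs_normsq M T = \esum_(x in [set: nat * nat])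
     (sqn (c x) * (1 - (chain_size k 0 (d x))%:R^-1))%:E)%E.
Proof.
move=> Tc; rewrite (@hs_normsq_kernel R M T (fun x => (c x)^*%C *: kernel (d x))).
- apply: eq_esum => x _; have hK := hardy2_kernel R k (d x).
  by rewrite nrmE; [rewrite nrmZ// sqnJ nrm_kernel|exact: hardy2Z].
- by move=> f [].
- by exists (@helmert_basis R k); exact: helmert_orthonormal_basis.
- move=> x; have [hK K0] := submodule_chain_null k_gt0 (kernel_submodule R k_gt0 (d x)).
  apply: chain_null_submodule => //; split=> [|a b ak]; first exact: hardy2Z.
  by rewrite -(mulr_sumr _ (fun=> true)) K0// mulr0.
- move=> f x Mf; have [hf _] := Mf; rewrite innerZr ?conjcK//; last exact: hardy2_kernel.
  by rewrite inner_kernel// Tc.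
Qed.

Lemma submodule00 f n : M f -> (n < k)%N -> f (0%N, n) = 0.
Proof.
move=> /(submodule_chain_null k_gt0)[_ f0] nk; have := f0 0%N n k_gt0.
by rewrite chain_size_start// divn_small// big_ord1 /pt mul0n addn0 subn0.
Qed.

(** As multiplication by z is isometric, this acts on M as the orthogonal projection onto the
    complement of zM. *)
Definition defect_z f : H := commutator (adj M (@mulz R)) (@mulz R) f.

Lemma defect_zE f a b : M f -> defect_z f (a, b) =
  if a is a'.+1 then
    (if (k %| a)%N then - ((chain_size k a' b)%:R^-1 * f (0, a + b)%N) else 0)
  else f (0%N, b).
Proof.
move=> Mf; rewrite /defect_z /commutator !adj_mulz//; last exact: submodule_mulz.
rewrite -[LHS]/(adjz k (mulz f) (a, b) - mulz (adjz k f) (a, b)) /adjz /=.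
rewrite mulr0 if_same addr0.
case: a => [|a] /=; first by rewrite subr0.
by rewrite opprD addNKr addnS addSn; case: ifP; rewrite ?oppr0.
Qed.

Lemma defect_z_submodule f : M f -> M (defect_z f).
Proof.
move=> Mf; rewrite /defect_z /commutator !adj_mulz//; last exact: submodule_mulz.
apply: submoduleB => //; last exact/submodule_mulz/adjz_submodule.
exact/adjz_submodule/submodule_mulz.
Qed.

Lemma defect_wE f : M f ->
  commutator (adj M (@mulw R)) (@mulw R) f = swap (defect_z (swap f)).
Proof.
move=> Mf; have Ms := submodule_swap k_gt0 Mf.
rewrite /defect_z /commutator !adj_mulw//; last exact: submodule_mulw.
by rewrite !adj_mulz// -?mulwE//; exact: submodule_mulz.
Qed.

Lemma chain_size_pred a b : (0 < a)%N -> (k %| a)%N ->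
  chain_size k a.-1 b = (a %/ k + b %/ k)%N.
Proof.
move=> a0 /dvdnP[s sE]; rewrite /chain_size sE mulnK//.
have s0 : (0 < s)%N by move: a0; rewrite sE; case: s {sE}.
have -> : ((s * k).-1 = s.-1 * k + k.-1)%N by rewrite -{1}(prednK s0) mulSn; lia.
by rewrite divnMDl// divn_small ?prednK// addn0; lia.
Qed.

(** Indexed by exponents divided by k. At the origin the operator returns f(0, 0), which vanishes on
    M because its chain is a single point; this justifies the value 0 there. *)
Definition coef0 (x : nat * nat) : C :=
  if (x.1 + x.2 == 0)%N then 0 else
  if x.2 == 0%N then - x.1%:R^-1 else (x.1 + x.2)%:R^-2.

Lemma Sigma0_operatorE f x : M f ->
  (commutator (adj M (@mulw R)) (@mulw R) \o commutator (adj M (@mulz R)) (@mulz R)) f x =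
  (if (k %| x.1)%N && (k %| x.2)%N then coef0 (x.1 %/ k, x.2 %/ k)%N else 0) *
  f (0, x.1 + x.2)%N.
Proof.
case: x => a b Mf; rewrite [LHS](_ : _ = swap (defect_z (swap (defect_z f))) (a, b)); last first.
  by rewrite -defect_wE//; exact: defect_z_submodule.
have Md := defect_z_submodule Mf; have Ms := submodule_swap k_gt0 Md.
rewrite /swap /= defect_zE//= /coef0 /=.
have dn n : (0 < n)%N -> defect_z f (n, 0)%N =
    if (k %| n)%N then - ((n %/ k)%:R^-1 * f (0, n)%N) else 0.
  case: n => // n _; rewrite defect_zE//; case: ifP => // kn.
  by rewrite (chain_size_pred 0 (ltn0Sn n) kn) div0n !addn0.
case: b => [|b].
  rewrite dvdn0 andbT div0n !addn0 /=; case: a => [|a].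
    by rewrite dvdn0 div0n eqxx mul0r defect_zE// submodule00.
  rewrite dn//; case: ifP => [ka|]; last by rewrite mul0r.
  have a0 : (0 < a.+1 %/ k)%N by rewrite divn_gt0// dvdn_leq.
  by rewrite gtn_eqF// mulNr.
rewrite andbC; case: ifP => [kb|]; last by rewrite mul0r.
rewrite (chain_size_pred a (ltn0Sn b) kb) dn//.
rewrite (dvdn_addr a kb) /=; case: ifP => [ka|]; last by rewrite mulr0 oppr0 mul0r.
have b0 : (0 < b.+1 %/ k)%N by rewrite divn_gt0// dvdn_leq.
rewrite divnDl// [(b.+1 + a)%N]addnC [(b.+1 %/ k + _)%N]addnC.
rewrite (gtn_eqF b0) gtn_eqF ?ltn_addl// mulrN opprK mulrA.
by rewrite expr2 invfM.
Qed.

Lemma Sigma0E : (Sigma0 M = \sum_(0 <= m <oo) ((m%:R^-1) ^+ 2 : R)%:E)%E.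
Proof.
rewrite /Sigma0 (hs_normsq_weighted Sigma0_operatorE).
pose G (x : nat * nat) : R := sqn (coef0 x) * (1 - (x.1 + x.2).+1%:R^-1).
rewrite (eq_esum (b := fun x => if (k %| x.1)%N && (k %| x.2)%N
    then (G (x.1 %/ k, x.2 %/ k)%N)%:E else 0%E)); last first.
  move=> [a b] _ /=; case: ifP => [/andP[ka kb]|_]; last by rewrite sqn0 mul0r.
  by rewrite /G /chain_size div0n add0n divnDl.
have G0 x : (0 <= (G x)%:E)%E.
  by rewrite lee_fin mulr_ge0 ?sqn_ge0// subr_ge0 invf_le1 ?ler1n// ltr0n.
rewrite (esum_multiples k_gt0 G0) esum_antidiagonal//.
apply: eq_eseriesr => m _; rewrite sumEFin; congr EFin; rewrite /G /coef0 /=.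
have E (a : 'I_m.+1) : (a + (m - a) = m)%N by rewrite subnKC// -ltnS.
(* For quotients of sum m > 0, the point with second quotient 0 contributes m^-2 and each of the m
   others m^-4. The kernel norm m/(m + 1) brings the total to m^-2. For m = 0 both sides are 0, the
   inverse of 0 being 0. *)
rewrite (eq_bigr (fun a : 'I_m.+1 => (if m == 0%N then 0 else
    if (m - val a == 0)%N then m%:R^-1 ^+ 2 else m%:R ^- 4) * (1 - m.+1%:R^-1))); last first.
  move=> a _; rewrite E; congr (_ * _); case: ifP => _; first by rewrite sqn0.
  case: ifP => [/eqP am|_]; last by rewrite sqnV sqnM sqn_nat -exprD.
  have -> : val a = m by apply/eqP; rewrite eqn_leq -ltnS ltn_ord -subn_eq0 am.
  by rewrite sqnN sqnV sqn_nat exprVn.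
rewrite -mulr_suml; case: m E => [|m] _ /=.
  by rewrite big_ord1 mul0r invr0 expr0n.
rewrite big_ord_recr /= subnn eqxx (eq_bigr (fun=> m.+1%:R ^- 4)); last first.
  by move=> i _; rewrite ifF//; have := ltn_ord i; lia.
rewrite sumr_const card_ord -[_ ^- 4 *+ _]mulr_natr -[m.+2%:R]natr1.
have m0 : (m.+1%:R : R) != 0 by rewrite pnatr_eq0.
have m1 : (m.+1%:R + 1 : R) != 0 by rewrite natr1 pnatr_eq0.
by move: (m.+1%:R : R) m0 m1 => x m0 m1; field; rewrite m0 m1.
Qed.

End Sigma01.

Section Sigma1.
Variable R : realType.
Local Notation C := R[i].
Local Notation H := (nat * nat -> C).
Implicit Types (f g : H).
Variable k : nat.
Hypothesis k_gt0 : (0 < k)%N.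
Local Notation M := (submodule_gen (zk_sub_wk R k)).

(** The first index stands for (a + 1) %/ k, which is positive where the operator survives; the
    value 0 on the axis lets [esum_shift1] absorb the shift from a to a + 1. *)
Definition coef1 (x : nat * nat) : C :=
  if x.1 == 0%N then 0 else
  if x.2 == 0%N then x.1%:R^-1 else (x.1 + x.2)%:R^-1 - (x.1 + x.2).-1%:R^-1.

(** Multiplication by w commutes with the backward shift up to the corrections. These involve the
    chain lengths at (a, b) and (a, b - 1), which differ only when k | b. *)
Lemma Sigma1_operatorE f x : M f ->
  commutator (adj M (@mulz R)) (@mulw R) f x =
  (if (k %| x.1.+1)%N && (k %| x.2)%N then coef1 (x.1.+1 %/ k, x.2 %/ k)%N else 0) *
  f (0, x.1 + x.2)%N.
Proof.
case: x => a b Mf; rewrite /commutator !adj_mulz//; last exact: submodule_mulw.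
rewrite -[LHS]/(adjz k (mulw f) (a, b) - mulw (adjz k f) (a, b)) /adjz /coef1 /=.
rewrite {2}/mulw /= addnS /=.
have [ka|nka] := boolP (k %| a.+1)%N; last first.
  by rewrite mul0r /mulw /=; case: b => [|b] /=; rewrite ?(negbTE nka) !addr0 subrr.
have sa : (0 < a.+1 %/ k)%N by rewrite divn_gt0// dvdn_leq.
have LE c : chain_size k a c = (a.+1 %/ k + c %/ k)%N.
  by rewrite -(chain_size_pred k_gt0 c (ltn0Sn a) ka).
rewrite /mulw /= gtn_eqF//.
case: b => [|b] /=; first by rewrite dvdn0 LE div0n !addn0 add0r subr0.
rewrite !LE [(a + b.+1)%N]addnS ka opprD addrACA subrr add0r -mulrBl.
have [kb|kb] := boolP (k %| b.+1)%N.
  have sb : (0 < b.+1 %/ k)%N by rewrite divn_gt0// dvdn_leq.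
  have := chain_size_pred k_gt0 0 (ltn0Sn b) kb.
  rewrite /chain_size /= div0n !addn0 gtn_eqF// => <- /=.
  by rewrite addnS.
have -> : (b.+1 %/ k = b %/ k)%N by rewrite divnS// (negbTE kb).
by rewrite subrr.
Qed.

(* Here [M] is the length of a chain.  The terms [M = 0] and [M = 1] vanish
   because of the division by 0. *)
Definition sigma_term (c M : nat) : R := ((M - c)%:R / (M * M.-1)%:R) ^+ 2.

Lemma Sigma1E : (Sigma1 M = \sum_(0 <= m <oo) (sigma_term 1 m)%:E)%E.
Proof.
rewrite /Sigma1 (hs_normsq_weighted k_gt0 Sigma1_operatorE).
pose G (x : nat * nat) : R := sqn (coef1 x) * (1 - (x.1 + x.2)%:R^-1).
have G0 x : (0 <= (G x)%:E)%E.
  rewrite lee_fin /G /coef1; case: eqP => x0; first by rewrite sqn0 mul0r.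
  by rewrite mulr_ge0 ?sqn_ge0// subr_ge0 invf_le1 ?ler1n ?ltr0n; lia.
pose F (x : nat * nat) := if (k %| x.1)%N && (k %| x.2)%N
    then (G (x.1 %/ k, x.2 %/ k)%N)%:E else 0%E.
have F0 x : (0 <= F x)%E by rewrite /F; case: ifP.
rewrite (eq_esum (b := fun x => F (x.1.+1, x.2))); last first.
  move=> [a b] _; rewrite /F /=; case: ifP => [/andP[ka kb]|_]; last by rewrite sqn0 mul0r.
  rewrite /G; congr (_ * (1 - _%:R^-1))%:E; rewrite /= -divnDl// /chain_size div0n add0n.
  have := chain_size_pred k_gt0 0 (ltn0Sn (a + b)) (dvdn_add ka kb).
  by rewrite /chain_size div0n !addn0.
rewrite esum_shift1//; last first.
  move=> b; rewrite /F /= dvdn0 div0n /=; case: ifP => // _.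
  by rewrite /G /coef1 /= sqn0 mul0r.
rewrite (esum_multiples k_gt0 G0) esum_antidiagonal//.
apply: eq_eseriesr => m _; rewrite sumEFin; congr EFin; rewrite /G /coef1 /=.
have E (a : 'I_m.+1) : (a + (m - a) = m)%N by rewrite subnKC// -ltnS.
case: m E => [|m] E.
  by rewrite big_ord1 /= sqn0 mul0r /sigma_term !mul0n invr0 mulr0 expr0n.
(* For quotients of sum m + 1, the first term is 0, the last has squared coefficient (m + 1)^-2, and
   the m between share ((m + 1)^-1 - m^-1)^2. Weighted by 1 - 1/(m + 1), they add up to (m + 1)^-2
   if m > 0 and to 0 if m = 0. *)
rewrite big_ord_recl /= sqn0 mul0r add0r big_ord_recr /=.
rewrite /bump /= add1n subnn addn0 /= sqnV sqn_nat.
have m0 : (m.+1%:R : R) != 0 by rewrite pnatr_eq0.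
rewrite (eq_bigr (fun=> (m.+1%:R^-1 - m%:R^-1) ^+ 2 * (1 - m.+1%:R^-1))); last first.
  move=> i _; rewrite add1n subSS; have im := ltn_ord i.
  rewrite (_ : (m - i == 0)%N = false); last by lia.
  rewrite (_ : (i.+1 + (m - i) = m.+1)%N) /=; last by lia.
  congr (_ * _).
  by rewrite -[RHS]sqn_real rmorphB !fmorphV !rmorph_nat add0n subnKC// ltnW.
rewrite sumr_const card_ord -[X in X + _]mulr_natr /sigma_term subn1 natrM /=.
case: m m0 E => [|m] m0 _.
  by rewrite mulr0 mul0r expr0n invr1 subrr mulr0 addr0.
have m1 : (m.+1%:R : R) != 0 by rewrite pnatr_eq0.
by move: m0; rewrite -[m.+2%:R]natr1; move: (m.+1%:R : R) m1 => x m1 m0; field; rewrite m0 m1.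
Qed.

End Sigma1.

(** * The higher invariants *)

(** Cramer's rule: multiply A c = gam e_i0 by the adjugate. One solved system thus yields a whole
    row of cofactors. *)
Lemma cofactor_solution (F : comNzRingType) n (A : 'M[F]_n) (c : 'cV[F]_n)
    (gam : F) (i0 l : 'I_n) :
  (forall i, \sum_(l < n) A i l * c l 0 = gam * (i == i0)%:R) ->
  \det A * c l 0 = gam * cofactor A i0 l.
Proof.
move=> Ac; have E : A *m c = gam *: delta_mx i0 0.
  by apply/matrixP => i j; rewrite (ord1 j) !mxE Ac !eqxx andbT.
have := congr1 (fun B => (\adj A *m B) l 0) E.
rewrite mulmxA mul_adj_mx mul_scalar_mx mxE => ->.
by rewrite -scalemxAr mxE -colE !mxE.
Qed.

Section Higher.
Variable R : realType.
Local Notation C := R[i].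
Local Notation H := (nat * nat -> C).
Local Notation z := ('X : {poly {poly C}}).
Local Notation w := ('X%:P : {poly {poly C}}).
Implicit Types (f g : H).
Variable k : nat.
Hypothesis k_gt0 : (0 < k)%N.
Local Notation p := (zk_sub_wk R k).
Local Notation bvec n l := (of_poly (p * z ^+ l * w ^+ (n - l))).
Local Notation K n := (n %/ k).+1.

(* A multiple of [phi n], normalised to have coefficient 1 at w^(n+k). *)
Definition wandering n : H := fun x =>
  if (x.1 + x.2 == n + k)%N && (k %| x.1)%N
  then (if x.1 == 0%N then 1 else - (K n)%:R^-1) else 0.

(** Minus the partial sums of [wandering n] along its chain: each Gram vector is a difference of
    neighbours, so these coefficients come from summation by parts. The expression vanishes at l = k
    K, where the chain ends. *)
Definition wandering_coef n l : C :=
  if (k %| l)%N then (l %/ k)%:R / (K n)%:R - 1 else 0.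

Lemma hardy2_wandering n : hardy2 (wandering n).
Proof.
apply: (@hardy2_fin _ _ (n + k).+1) => a b ab; rewrite /wandering /=.
by rewrite (_ : (a + b == n + k)%N = false)//; lia.
Qed.

Lemma bvecE n l : bvec n l = delta R (l + k, n - l)%N - delta R (l, n - l + k)%N.
Proof. exact: of_poly_zk_sub_wk_monomial. Qed.

Lemma sum_delta (I : finType) (c : I -> C) (q : I -> nat * nat) x (P : bool) (i : I) :
  (forall l, (x == q l) = P && (l == i)) ->
  \sum_l c l * delta R (q l) x = if P then c i else 0.
Proof.
move=> E; rewrite (eq_bigr (fun l => if P && (l == i) then c l else 0)).
  by case: P {E} => /=; [rewrite -big_mkcond big_pred1_eq|rewrite big1].
by move=> l _; rewrite /delta E; case: ifP => _; rewrite ?mulr1 ?mulr0.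
Qed.

Lemma sum_wandering n :
  \sum_(l < n.+1) wandering_coef n l *: bvec n l = wandering n.
Proof.
apply/funext => -[a b]; rewrite fct_sumE.
rewrite (eq_bigr (fun l : 'I_n.+1 => wandering_coef n l * delta R (l + k, n - l)%N (a, b)
   - wandering_coef n l * delta R (val l, n - l + k)%N (a, b))); last first.
  by move=> l _; rewrite bvecE -mulrBr.
rewrite sumrB.
rewrite (@sum_delta _ _ _ _ ((k <= a)%N && (a + b == n + k)%N) (inord (a - k))); last first.
  move=> l; rewrite xpair_eqE -val_eqE /=.
  have [/andP[ka /eqP ab]|nab] := boolP ((k <= a)%N && (a + b == n + k)%N).
    by rewrite inordK /=; have := ltn_ord l; lia.
  by have := ltn_ord l; lia.
rewrite (@sum_delta _ _ _ _ ((a <= n)%N && (a + b == n + k)%N) (inord a)); last first.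
  move=> l; rewrite xpair_eqE -val_eqE /=.
  have [/andP[an /eqP ab]|nab] := boolP ((a <= n)%N && (a + b == n + k)%N).
    by rewrite inordK /=; have := ltn_ord l; lia.
  by have := ltn_ord l; lia.
rewrite /wandering /=; have [ab|_] := eqVneq (a + b)%N (n + k)%N; last first.
  by rewrite !andbF subrr.
rewrite !andbT /= /wandering_coef.
have K0 : ((K n)%:R : C) != 0 by rewrite pnatr_eq0.
have [ka|nka] := boolP (k %| a)%N; last first.
  rewrite (_ : (if (a <= n)%N then _ else 0) = 0) ?subr0; last first.
    by case: ifP => // an; rewrite inordK// (negbTE nka).
  case: ifP => // lka; rewrite inordK; last by lia.
  rewrite ifF//; apply: contraNF nka => h.
  by rewrite -(subnK lka) dvdn_add.
have [s aE] := dvdnP ka; rewrite aE in ab *.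
rewrite (_ : (if (s * k <= n)%N then _ else 0) = s%:R / (K n)%:R - 1); last first.
  case: ifP => an; first by rewrite inordK// dvdn_mull// mulnK.
  suff -> : s = K n by rewrite mulfV// subrr.
  have ns : (n %/ k < s)%N by rewrite ltn_divLR// ltnNge an.
  have sn : (s.-1 <= n %/ k)%N by rewrite leq_divRL// -subn1 mulnBl mul1n; lia.
  by lia.
case: s {aE ka} ab => [|s] ab.
  by rewrite mul0n leqNgt k_gt0 /= mul0r !sub0r opprK.
rewrite mulSn leq_addr addKn inordK; last by move: ab; rewrite mulSn; lia.
rewrite dvdn_mull// mulnK// addn_eq0 (gtn_eqF k_gt0) /= -[s.+1%:R]natr1.
by move: ((K n)%:R : C) K0 => x x0; field.
Qed.

(** Past its first point [wandering n] is constant on its chain, so only the difference that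
    involves w^(n+k) is detected. *)
Lemma inner_wandering_bvec n i : (i <= n)%N ->
  inner (wandering n) (bvec n i) = (- (K n)%:R^-1 - 1) * (i == 0%N)%:R.
Proof.
move=> iln; have hd := hardy2_delta R.
rewrite bvecE innerBr//; last exact: hardy2_wandering.
rewrite !inner_delta /wandering /= dvdn_addl//.
rewrite (_ : (i + k + (n - i) == n + k)%N = true); last by lia.
rewrite (_ : (i + (n - i + k) == n + k)%N = true); last by lia.
rewrite addn_eq0 (gtn_eqF k_gt0) andbF /=.
have [->|i0] := eqVneq i 0%N; first by rewrite dvdn0 mulr1.
by rewrite mulr0; case: ifP; rewrite subrr.
Qed.

Lemma swap_bvec n l : (l <= n)%N -> swap (bvec n l) = - bvec n (n - l).
Proof.
move=> ln; apply/funext => -[a b]; rewrite !bvecE.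
rewrite -[LHS]/(delta R (l + k, n - l)%N (b, a) - delta R (l, n - l + k)%N (b, a)).
rewrite -[RHS]/(- (delta R (n - l + k, n - (n - l))%N (a, b) -
  delta R (n - l, n - (n - l) + k)%N (a, b))).
rewrite subKn// opprB /delta; congr (_%:R - _%:R); congr nat_of_bool;
  rewrite !xpair_eqE; lia.
Qed.

Lemma swapZ (c : C) f : swap (c *: f) = c *: swap f.
Proof. by []. Qed.

Lemma swap_sum (I : Type) (r : seq I) (F : I -> H) :
  swap (\sum_(i <- r) F i) = \sum_(i <- r) swap (F i).
Proof. by elim/big_rec2: _ => // i f g _ <-. Qed.

Lemma sum_swap_wandering n :
  \sum_(l < n.+1) wandering_coef n (n - l) *: bvec n l = - swap (wandering n).
Proof.
rewrite -sum_wandering swap_sum -sumrN (reindex_inj rev_ord_inj) /=.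
apply: eq_bigr => l _; have ln : (l <= n)%N by rewrite -ltnS.
by rewrite swapZ swap_bvec// scalerN opprK subSS subKn.
Qed.

Lemma gram_wandering n (i : 'I_n.+1) :
  \sum_(l < n.+1) gram p n i l * wandering_coef n l =
  (- (K n)%:R^-1 - 1) * (i == ord0)%:R.
Proof.
have iln : (i <= n)%N by rewrite -ltnS.
rewrite -(@inner_wandering_bvec n i)// -sum_wandering inner_suml; last 2 first.
- by move=> l; exact/hardy2Z/hardy2_of_poly.
- exact: hardy2_of_poly.
by apply: eq_bigr => l _; rewrite innerZl ?mxE 1?mulrC//; exact: hardy2_of_poly.
Qed.

Lemma gram_swap_wandering n (i : 'I_n.+1) :
  \sum_(l < n.+1) gram p n i l * wandering_coef n (n - l) =
  (- (K n)%:R^-1 - 1) * (i == ord_max)%:R.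
Proof.
have iln : (i <= n)%N by rewrite -ltnS.
have -> : (i == ord_max) = (n - i == 0)%N by rewrite -val_eqE /=; lia.
rewrite -(@inner_wandering_bvec n (n - i)) ?leq_subr//.
have hb m l := hardy2_of_poly (p * z ^+ l * w ^+ (m - l)).
transitivity (inner (- swap (wandering n)) (bvec n i)).
  rewrite -sum_swap_wandering inner_suml//; last by move=> l; exact: hardy2Z.
  by apply: eq_bigr => l _; rewrite innerZl// mxE mulrC.
rewrite -[bvec n i in LHS](swapK) swap_bvec// -scaleN1r.
rewrite (_ : swap (- _) = -1 *: swap (bvec n (n - i))); last by rewrite -swapZ scaleN1r.
have hs := hardy2_swap (hardy2_wandering n); have hs' := hardy2_swap (hb n (n - i)%N).
rewrite innerZl ?innerZr//; last exact: hardy2Z.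
by rewrite mulrA mulcJ inner_swap sqnN (sqn_nat R 1) expr1n mul1r.
Qed.

Lemma gramE n (i l : 'I_n.+1) : gram p n i l =
  (val i == val l)%:R + (val i == val l)%:R - (i + k == l)%N%:R - (val i == l + k)%N%:R.
Proof.
have [iln lln] := (ltn_ord i, ltn_ord l).
rewrite mxE !bvecE innerBr; [|exact: hardy2_delta|exact: hardy2_delta|
  by apply: hardy2B; exact: hardy2_delta].
rewrite !inner_delta.
rewrite -[LHS]/(((i + k, n - i)%N == (l + k, n - l)%N)%:R -
  ((i + k, n - i)%N == (val l, n - l + k)%N)%:R -
  (((val i, n - i + k)%N == (l + k, n - l)%N)%:R -
  ((val i, n - i + k)%N == (val l, n - l + k)%N)%:R)).
rewrite !xpair_eqE /=.
have -> : (i + k == l + k)%N && (n - i == n - l)%N = (val i == val l) by rewrite /=; lia.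
have -> : (val i == val l) && (n - i + k == n - l + k)%N = (val i == val l) by rewrite /=; lia.
have -> : (i + k == l)%N && (n - i == n - l + k)%N = (i + k == l)%N by lia.
have -> : (val i == l + k)%N && (n - i + k == n - l)%N = (val i == l + k)%N by rewrite /=; lia.
ring.
Qed.

(** The Gram matrix is Toeplitz, with 2 on the diagonal and -1 at distance k, so deleting its first
    row and column leaves the preceding Gram matrix. *)
Lemma cofactor_first n : cofactor (gram p n) ord0 ord0 = gram_det p n.
Proof.
rewrite /cofactor expr0 mul1r; case: n => [|n]; first exact: det_mx00.
congr (\det _); apply/matrixP => i l; rewrite 2![in LHS]mxE !gramE /= /bump /=.
by rewrite !add1n !eqSS.
Qed.

Lemma gram_det_wandering n l : (l <= n)%N ->
  gram_det p n.+1 * wandering_coef n l =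
  (- (K n)%:R^-1 - 1) * cofactor (gram p n) ord0 (inord l).
Proof.
move=> ln; pose c := \col_(l < n.+1) wandering_coef n l.
have -> : wandering_coef n l = c (inord l) 0 by rewrite mxE inordK.
apply: cofactor_solution => i; under eq_bigr do rewrite [c _ _]mxE.
exact: gram_wandering.
Qed.

Lemma gram_det_swap_wandering n l : (l <= n)%N ->
  gram_det p n.+1 * wandering_coef n (n - l) =
  (- (K n)%:R^-1 - 1) * cofactor (gram p n) ord_max (inord l).
Proof.
move=> ln; pose c := \col_(l < n.+1) wandering_coef n (n - l).
have -> : wandering_coef n (n - l) = c (inord l) 0 by rewrite mxE inordK.
apply: cofactor_solution => i; under eq_bigr do rewrite [c _ _]mxE.
exact: gram_swap_wandering.
Qed.

(** Cramer's rule in the component l = 0, where the coefficient is -1 and the cofactor is the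
    preceding determinant. *)
Lemma gram_detS n :
  gram_det p n.+1 = (((K n)%:R^-1 + 1 : R)%:C)%C * gram_det p n.
Proof.
have := gram_det_wandering (leq0n n).
rewrite (_ : inord 0 = ord0); last by apply/val_inj; rewrite /= inordK.
rewrite cofactor_first /wandering_coef dvdn0 div0n mul0r sub0r mulrN1.
rewrite rmorphD fmorphV rmorph_nat rmorph1 -opprD mulNr => /eqP.
by rewrite eqr_opp => /eqP.
Qed.

Definition gram_det_real n : R := \prod_(i < n) ((K i)%:R^-1 + 1).

Lemma gram_det_realE n : gram_det p n = ((gram_det_real n)%:C)%C.
Proof.
elim: n => [|n IHn]; first by rewrite /gram_det_real big_ord0.
by rewrite gram_detS IHn /gram_det_real big_ord_recr /= -real_complexM mulrC.
Qed.

Lemma gram_det_real_gt0 n : 0 < gram_det_real n.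
Proof. by apply: prodr_gt0 => i _; rewrite addr_gt0// invr_gt0 ltr0n. Qed.

Lemma sqn_sqrtC (r : R) : 0 <= r -> sqn (sqrtC (r%:C)%C) = r.
Proof.
move=> r0; apply/eqP; rewrite -(@eqrXn2 _ 2) ?sqn_ge0//.
by rewrite expr2 -sqnM -expr2 sqrtCK sqn_real.
Qed.

(** Here |u|^2 is the inverse of the squared norm 1 + K/K^2 of [wandering n]. The phase of u stays
    unspecified, since Sigma_j only sees |u|. The minus sign in psi_n reflects the antisymmetry of
    z^k - w^k. *)
Lemma sqn_wandering_scale n : exists2 u : C, sqn u = (K n)%:R / (K n).+1%:R &
  phi p n = u *: wandering n /\ psi p n = - u *: swap (wandering n).
Proof.
pose d := gram_det_real; have d0 := gram_det_real_gt0.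
pose gam : C := - (K n)%:R^-1 - 1.
have gamE : gam = ((- ((K n)%:R^-1 + 1) : R)%:C)%C.
  by rewrite rmorphN rmorphD fmorphV rmorph_nat rmorph1 opprD.
have g0 : (K n)%:R^-1 + 1 != 0 :> R by rewrite gt_eqF// addr_gt0// invr_gt0 ltr0n.
have gam0 : gam != 0 by rewrite gamE -sqn_eq0 sqn_real sqrf_eq0 oppr_eq0.
pose u : C := (sqrtC (gram_det p n * gram_det p n.+1))^-1 * (gram_det p n.+1 / gam).
have cofE (i l : 'I_n.+1) c : gram_det p n.+1 * c = gam * cofactor (gram p n) i l ->
    cofactor (gram p n) i l = gram_det p n.+1 / gam * c.
  by move=> h; rewrite mulrAC h mulrAC mulfV// mul1r.
exists u.
  rewrite /u !sqnM !sqnV gamE sqn_real !gram_det_realE -real_complexM.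
  rewrite sqn_sqrtC ?mulr_ge0 ?ltW// sqn_real {2 3}/gram_det_real big_ord_recr /=.
  rewrite -/(gram_det_real n) -[(K n).+1%:R]natr1; have := gt_eqF (d0 n); move/negbT.
  have := g0; have : ((K n)%:R : R) != 0 by rewrite pnatr_eq0.
  have : ((K n)%:R + 1 : R) != 0 by rewrite natr1 pnatr_eq0.
  move: ((K n)%:R : R) (gram_det_real n) => x y x1 x0 x2 y0.
  by field; rewrite x0 y0 x1.
rewrite /phi /psi /cofactor_vector; split.
  rewrite -sum_wandering /u -scalerA; congr (_ *: _); rewrite scaler_sumr.
  apply: eq_bigr => l _; rewrite scalerA; congr (_ *: _); apply: cofE.
  by rewrite gram_det_wandering ?inord_val// -ltnS.
rewrite scaleNr -scalerN -sum_swap_wandering /u -scalerA; congr (_ *: _); rewrite scaler_sumr.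
apply: eq_bigr => l _; rewrite scalerA; congr (_ *: _); apply: cofE.
by rewrite gram_det_swap_wandering ?inord_val// -ltnS.
Qed.

End Higher.

(** The origin of the ceiling: (j - 1) %/ k + 1 = ceil(j/k) multiples of k, counting 0, lie below j.
    Truncated subtraction covers the case j > N. *)
Lemma count_multiples k j N : (0 < k)%N -> (0 < j)%N ->
  (\sum_(a < N.+1) (k %| a) && (j <= a) = N %/ k - j.-1 %/ k)%N.
Proof.
move=> k0 j0; elim: N => [|N IHN].
  by rewrite big_ord1 leqNgt j0 andbF div0n.
rewrite big_ord_recr /= IHN divnS//; have [kN|_] /= := boolP (k %| N.+1)%N; last first.
  by rewrite addn0.
have [jN|Nj] := leqP j N.+1.
  rewrite add1n subSn ?addn1//; apply: leq_div2r; lia.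
rewrite addn0; have h : (N.+1 %/ k <= j.-1 %/ k)%N by apply: leq_div2r; lia.
have : (N %/ k <= N.+1 %/ k)%N by apply: leq_div2r.
by rewrite divnS// kN in h *; lia.
Qed.

(** * Inner products of shifted wandering vectors *)

Section SigmaHigher.
Variable R : realType.
Local Notation C := R[i].
Local Notation H := (nat * nat -> C).
Implicit Types (f g : H).
Variable k : nat.
Hypothesis k_gt0 : (0 < k)%N.
Local Notation p := (zk_sub_wk R k).
Local Notation K n := (n %/ k).+1.
Local Notation wandering := (wandering R k).

Lemma iter_mulwE f j a b :
  iter j (@mulw R) f (a, b) = if (j <= b)%N then f (a, b - j)%N else 0.
Proof.
elim: j b => [|j IHj] b; first by rewrite subn0.
by case: b => [|b] //; rewrite -[LHS]/(iter j (@mulw R) f (a, b)) IHj subSS ltnS.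
Qed.

Lemma iter_mulzE f j a b :
  iter j (@mulz R) f (a, b) = if (j <= a)%N then f (a - j, b)%N else 0.
Proof.
elim: j a => [|j IHj] a; first by rewrite subn0.
by case: a => [|a] //; rewrite -[LHS]/(iter j (@mulz R) f (a, b)) IHj subSS ltnS.
Qed.

Lemma iter_mulwZ (c : C) f j : iter j (@mulw R) (c *: f) = c *: iter j (@mulw R) f.
Proof.
apply/funext => -[a b]; rewrite -[RHS]/(c * iter j (@mulw R) f (a, b)) !iter_mulwE.
by case: ifP => // _; rewrite mulr0.
Qed.

Lemma iter_mulzZ (c : C) f j : iter j (@mulz R) (c *: f) = c *: iter j (@mulz R) f.
Proof.
apply/funext => -[a b]; rewrite -[RHS]/(c * iter j (@mulz R) f (a, b)) !iter_mulzE.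
by case: ifP => // _; rewrite mulr0.
Qed.

Lemma hardy2_iter_mulz f j : hardy2 f -> hardy2 (iter j (@mulz R) f).
Proof. by move=> hf; elim: j => //= j; exact: hardy2_mulz. Qed.

Lemma hardy2_iter_mulw f j : hardy2 f -> hardy2 (iter j (@mulw R) f).
Proof.
by move=> hf; elim: j => //= j hj; rewrite mulwE; exact/hardy2_swap/hardy2_mulz/hardy2_swap.
Qed.

(** A common monomial has both exponents at least j > 0, so the exceptional coefficient 1 never
    occurs and both factors are multiples of -1/K. Both exponents are divisible by k, which forces k
    | n + j. *)
Lemma wandering_shift_prod n j a b : (0 < j)%N ->
  iter j (@mulw R) (wandering n) (a, b) *
    ((iter j (@mulz R) (swap (wandering n)) (a, b))^*)%C =
  ([&& a + b == n + k + j, (k %| n + j), k %| a, j <= a & j <= b]%N)%:R *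
  (K n)%:R ^- 2.
Proof.
move=> j0; rewrite iter_mulwE iter_mulzE /swap /wandering /=.
have [jb|_] := leqP j b; last by rewrite !andbF !mul0r.
have [ja|_] := leqP j a; last by rewrite conjc0 mulr0 !andbF mul0r.
rewrite (_ : (a + (b - j) == n + k)%N = (a + b == n + k + j)%N); last by lia.
rewrite (_ : (b + (a - j) == n + k)%N = (a + b == n + k + j)%N); last by lia.
have [ab|_] := eqVneq (a + b)%N (n + k + j)%N; last by rewrite !mul0r.
have [ka|_] := boolP (k %| a)%N; last by rewrite mul0r !andbF mul0r.
have -> : (k %| b)%N = (k %| n + j)%N.
  by rewrite -(dvdn_addr b ka) ab addnAC dvdn_addl.
rewrite !gtn_eqF ?(leq_trans j0)//; have [_|_] := boolP (k %| n + j)%N; last first.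
  by rewrite conjc0 mulr0 mul0r.
by rewrite conjcN conjc_inv conjc_nat mulrNN mul1r expr2 invfM.
Qed.

Lemma inner_wandering_shift n j : (0 < j)%N ->
  inner (iter j (@mulw R) (wandering n)) (iter j (@mulz R) (swap (wandering n))) =
  (k %| n + j)%N%:R * (K n - j.-1 %/ k)%N%:R * (K n)%:R ^- 2.
Proof.
move=> j0; rewrite (@inner_fin _ _ _ (n + k + j).+1); last first.
  move=> a b ab; rewrite wandering_shift_prod//.
  by rewrite (_ : (a + b == _)%N = false) ?mul0r//; lia.
have -> : (K n - j.-1 %/ k = \sum_(a < (n + k).+1) (k %| a) && (j <= a))%N.
  by rewrite count_multiples// (_ : ((n + k) %/ k)%N = K n)// addnC -{1}[k]mul1n divnMDl.
rewrite natr_sum mulr_sumr mulr_suml /inner_partial.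
have le1 : ((n + k).+1 <= (n + k + j).+1)%N by lia.
rewrite [RHS](big_ord_widen _ (fun a =>
  (k %| n + j)%N%:R * ((k %| a) && (j <= a))%N%:R * (K n)%:R ^- 2) le1).
rewrite [RHS]big_mkcond; apply: eq_bigr => a _.
under eq_bigr do rewrite wandering_shift_prod//.
have aN := ltn_ord a.
have bP : (n + k + j - a < (n + k + j).+1)%N by lia.
rewrite (bigD1 (Ordinal bP))//= big1 ?addr0; last first.
  move=> b; rewrite -val_eqE /= => bne.
  by rewrite (_ : (a + b == _)%N = false) ?mul0r//; lia.
rewrite (_ : (a + (n + k + j - a) == n + k + j)%N = true); last by lia.
rewrite (_ : (j <= n + k + j - a)%N = (a < (n + k).+1)%N); last by lia.
case: ifP => _; last by rewrite !andbF mul0r.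
by rewrite andbT -natrM mulnb.
Qed.

Lemma Sigma_higher_termE n j : (0 < j)%N ->
  Normc.normc (inner (iter j (@mulw R) (phi p n)) (iter j (@mulz R) (psi p n))) ^+ 2 =
  if (k %| n + j)%N then sigma_term R (j.-1 %/ k).+1 (n %/ k).+2 else 0.
Proof.
move=> j0; rewrite -/(sqn _).
have [u uE [-> ->]] := sqn_wandering_scale R k_gt0 n.
have hw := hardy2_wandering R k_gt0 n.
have hjw := hardy2_iter_mulw j hw.
have hjz := hardy2_iter_mulz j (hardy2_swap hw).
rewrite iter_mulwZ iter_mulzZ innerZl ?innerZr//; last exact: hardy2Z.
rewrite inner_wandering_shift// !sqnM sqnJ sqnN uE; case: ifP => _; last first.
  by rewrite sqn0 !(mul0r, mulr0).
rewrite /sigma_term sqn_nat sqnV sqnM !sqn_nat subSS natrM /=.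
have : ((K n)%:R : R) != 0 by rewrite pnatr_eq0.
have : ((K n).+1%:R : R) != 0 by rewrite pnatr_eq0.
move: ((K n)%:R : R) ((K n).+1%:R : R) ((K n - j.-1 %/ k)%N%:R : R) => x y t y0 x0.
by field; rewrite x0 y0.
Qed.

Lemma sigma_term_ge0 c M : 0 <= sigma_term R c M.
Proof. exact: sqr_ge0. Qed.

Lemma Sigma_higherE j : (0 < j)%N ->
  (Sigma_higher p j = \sum_(0 <= m <oo) (sigma_term R (j.-1 %/ k).+1 m)%:E)%E.
Proof.
move=> j0; set c := (j.-1 %/ k).+1; rewrite /Sigma_higher.
under eq_eseriesr do rewrite Sigma_higher_termE//.
have st0 m : (0 <= (sigma_term R c m)%:E)%E by rewrite lee_fin sigma_term_ge0.
have jc : (j <= c * k)%N by have := ltn_ceil j.-1 k_gt0; rewrite -/c; lia.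
have cj : (c * k < j + k)%N.
  by have := leq_divM j.-1 k; rewrite /c mulSn; lia.
rewrite [LHS]nneseries_esumT; last by move=> n; case: ifP => _ //; exact: st0.
transitivity (\esum_(n in [set n | (k %| n + j)%N]) (sigma_term R c (n %/ k).+2)%:E)%E.
  rewrite [RHS]esum_mkcond; apply: eq_esum => n _.
  have [kn|/negP nkn] := boolP (k %| n + j)%N; first by rewrite mem_set.
  by rewrite memNset.
(* Each chain length m >= 2 comes from exactly one n with k | n + j, because 0 <= c k - j < k. The
   terms for m = 0 and m = 1 vanish. *)
rewrite (reindex_esum [set m | (1 < m)%N] _ (fun m => (m - 2) * k + (c * k - j))%N); last first.
  split=> //=.
  - by move=> m _ /=; rewrite -addnA subnK// -mulnDl dvdn_mull.
  - move=> m m' /[!inE] /= m1 m1' /addIn /eqP; rewrite eqn_pmul2r// => /eqP; lia.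
  - move=> n /= /dvdnP[t tE]; exists (t - c).+2 => //=.
    have ct : (c <= t)%N by rewrite /c ltn_divLR//; lia.
    have : (c * k <= t * k)%N by rewrite leq_mul2r ct orbT.
    by rewrite subn2 /= mulnBl; lia.
rewrite nneseries_esumT// esum_mkcond; apply: eq_esum => m _.
have [m1|m1] := ltnP 1 m; last first.
  rewrite memNset /=; last by rewrite /= ltnNge m1.
  by rewrite /sigma_term; case: m m1 => [|[|m]]// _; rewrite !muln0 invr0 mulr0 expr0n.
rewrite mem_set// divnMDl// (@divn_small (c * k - j)%N) ?addn0; last by lia.
by rewrite subn2; case: m m1 => [|[|m]].
Qed.

End SigmaHigher.

(** * The Basel problem *)

Section Basel.
Variable R : realType.
Implicit Types x : R.

(** The inequalities sin x <= x <= tan x come from the mean value theorem, and sin^-2 = 1 +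
    tan^-2. *)
Lemma inv_sin2_bounds x : 0 < x < pi / 2 ->
  x ^- 2 <= (sin x) ^- 2 <= x ^- 2 + 1.
Proof.
move=> /andP[x0 xpi]; have pi0 := pi_gt0 R.
have s0 : 0 < sin x by apply: sin_gt0_pihalf; rewrite x0.
have c0 y : 0 <= y <= x -> 0 < cos y.
  by move=> yx; apply: cos_gt0_pihalf; lra.
have sx : sin x <= x.
  have [c _] := MVT x0 (fun y _ => is_derive_sin y)
    (continuous_subspaceT (@continuous_sin R)).
  by rewrite sin0 !subr0 => ->; rewrite ler_piMl ?cos_le1// ltW.
have tx : x <= tan x.
  have [|y|c] := @MVT R (@tan R) (fun y => (cos y) ^- 2) 0 x x0.
  - move=> y; rewrite in_itv /= => /andP[y0 yx]; apply: is_derive_tan.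
    by rewrite gt_eqF// c0// (ltW y0) (ltW yx).
  - apply/continuous_in_subspaceT => z; rewrite inE /= in_itv /= => zx.
    by apply: continuous_tan; rewrite gt_eqF// c0.
  rewrite in_itv /= => /andP[c1 cx]; rewrite tan0 !subr0 => ->.
  have cc : 0 < cos c by rewrite c0// (ltW c1) (ltW cx).
  rewrite ler_peMl ?(ltW x0)// invf_ge1 ?exprn_gt0//.
apply/andP; split.
  by rewrite lef_pV2 ?posrE ?exprn_gt0// ler_pXn2r// nnegrE ltW.
have cx : 0 < cos x by rewrite c0// lexx ltW.
rewrite -lerBlDr (_ : _ - 1 = (tan x) ^- 2); last first.
  have c2 := cos2sin2 x; transitivity (cos x ^+ 2 / sin x ^+ 2).
    by rewrite c2; field; rewrite gt_eqF.
  by rewrite /tan; field; rewrite !gt_eqF.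
have t0 : 0 < tan x by exact: lt_le_trans tx.
by rewrite lef_pV2 ?posrE ?exprn_gt0// ler_pXn2r// nnegrE ltW.
Qed.

(* Hofbauer's proof: iterating this identity from [pi / 4] gives the exact value
   of the sum of [(sin x) ^- 2] over the odd multiples x of [pi / 2 ^ n.+2]
   below [pi / 2], while [(sin x) ^- 2] differs from [x ^- 2] by at most 1. *)
Lemma inv_sin2_half x : 0 < x < pi -> (sin x) ^- 2 =
  4^-1 * ((sin (x / 2)) ^- 2 + (sin (pi / 2 - x / 2)) ^- 2).
Proof.
move=> /andP[x0 xpi]; have pi0 := pi_gt0 R.
have s0 : 0 < sin (x / 2) by apply: sin_gt0_pihalf; lra.
have c0 : 0 < cos (x / 2) by apply: cos_gt0_pihalf; lra.
rewrite sinB sin_pihalf cos_pihalf mul1r mul0r subr0.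
have -> : sin x = 2 * (sin (x / 2) * cos (x / 2)).
  have xE : x = (x / 2) *+ 2 by rewrite mulr2n; lra.
  by rewrite {1}xE sin_mulr2n mulr2n; ring.
have c2 := cos2Dsin2 (x / 2).
transitivity (4^-1 * ((cos (x / 2) ^+ 2 + sin (x / 2) ^+ 2) / (sin (x / 2) * cos (x / 2)) ^+ 2)).
  by rewrite c2; field; rewrite !gt_eqF.
by field; rewrite !gt_eqF.
Qed.

Definition basel_angle n i : R := i.*2.+1%:R * pi / (2 ^ n.+2)%:R.

Lemma basel_angle_bound n i : (i < 2 ^ n)%N -> 0 < basel_angle n i < pi / 2.
Proof.
move=> ilt; have pi0 := pi_gt0 R.
have p0 : 0 < (2 ^ n.+2)%:R :> R by rewrite ltr0n expn_gt0.
apply/andP; split; first by rewrite divr_gt0// mulr_gt0.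
rewrite /basel_angle ltr_pdivrMr//.
have -> : pi / 2 * (2 ^ n.+2)%:R = (2 ^ n.+1)%:R * pi :> R.
  by rewrite [in LHS]expnS natrM; field.
by rewrite ltr_pM2r// ltr_nat expnS; lia.
Qed.

Lemma sum_inv_sin2 n :
  \sum_(i < 2 ^ n) (sin (basel_angle n i)) ^- 2 = 2 * (4 ^ n)%:R.
Proof.
elim: n => [|n IHn].
  have pi0 := pi_gt0 R; rewrite big_ord1 (_ : basel_angle 0 _ = pi / 2 / 2); last first.
    by rewrite /basel_angle /= double0 natrX; field.
  have pi2 : 0 < (pi : R) / 2 < pi by lra.
  have := inv_sin2_half pi2; rewrite sin_pihalf expr1n invr1.
  rewrite (_ : pi / 2 - pi / 2 / 2 = pi / 2 / 2 :> R); last by field.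
  by rewrite expn0 mulr1; move: (sin _ ^- 2) => t ?; lra.
rewrite expnS mulnC muln2 -addnn big_split_ord /=.
(* Reversing the second half pairs i with 2^(n+1) - 1 - i; for x = [basel_angle n i] their angles
   are x/2 and pi/2 - x/2. *)
rewrite [X in _ + X](reindex_inj rev_ord_inj) -big_split /=.
transitivity (\sum_(i < 2 ^ n) 4 * (sin (basel_angle n i)) ^- 2); last first.
  by rewrite -mulr_sumr IHn [in RHS]expnS natrM; ring.
apply: eq_bigr => i _; have /andP[a0 api] := basel_angle_bound (ltn_ord i).
have pi0 := pi_gt0 R.
rewrite (inv_sin2_half (x := basel_angle n i)); last by lra.
rewrite mulrA divff ?mul1r//.
have p0 : (2 ^ n.+2)%:R != 0 :> R by rewrite pnatr_eq0 expn_eq0.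
congr ((sin _) ^- 2 + (sin _) ^- 2).
  by rewrite /basel_angle [(2 ^ n.+3)%N]expnS natrM; field.
rewrite /basel_angle.
have -> : (2 ^ n + (2 ^ n - i.+1)).*2.+1%:R = (2 ^ n.+2)%:R - i.*2.+1%:R :> R.
  by rewrite -natrB; [congr _%:R|]; rewrite !expnS; have := ltn_ord i; lia.
by rewrite [(2 ^ n.+3)%N]expnS natrM; field.
Qed.

Definition inv_sq (m : nat) : R := (m%:R^-1) ^+ 2.

(** The sum of the inverse squared angles is 16 4^n / pi^2 times this sum. It falls short of 2 4^n
    by at most 1 for each of its 2^n terms, which after rescaling is the error pi^2/16 / 2^n. *)
Lemma odd_inv_sq_bounds n :
  pi ^+ 2 / 8 - pi ^+ 2 / 16 / 2 ^+ n <= \sum_(i < 2 ^ n) inv_sq i.*2.+1 <= pi ^+ 2 / 8.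
Proof.
have pi0 := pi_gt0 R; have p0 : 0 < (4 ^ n)%:R :> R by rewrite ltr0n expn_gt0.
have q0 : 0 < (2 : R) ^+ n by rewrite exprn_gt0.
have pq : (4 ^ n)%:R = 2 ^+ n * 2 ^+ n :> R.
  by rewrite -exprD natrX -[4%:R]/((2 * 2)%:R) natrM -expr2 -exprM mulnC addnn muln2.
pose S := \sum_(i < 2 ^ n) (basel_angle n i) ^- 2.
have SE : S = (16 * (4 ^ n)%:R / pi ^+ 2) * \sum_(i < 2 ^ n) inv_sq i.*2.+1.
  rewrite /S mulr_sumr; apply: eq_bigr => i _; rewrite /basel_angle /inv_sq.
  have -> : (2 ^ n.+2)%:R = 4 * 2 ^+ n :> R by rewrite !expnS !natrM natrX; ring.
  have m0 : (i.*2.+1%:R : R) != 0 by rewrite pnatr_eq0.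
  have [/lt0r_neq0 pi1 /lt0r_neq0 q1] := (pi0, q0).
  rewrite pq; move: (i.*2.+1%:R : R) (2 ^+ n : R) m0 q1 => m q m0 q1.
  by move: (pi : R) pi1 => P P0; field; rewrite m0 P0 q1.
have Sle : S <= 2 * (4 ^ n)%:R.
  rewrite -sum_inv_sin2; apply: ler_sum => i _.
  by have /andP[] := inv_sin2_bounds (basel_angle_bound (ltn_ord i)).
have leS : 2 * (4 ^ n)%:R <= S + 2 ^+ n.
  rewrite -sum_inv_sin2.
  have -> : (2 : R) ^+ n = \sum_(i < 2 ^ n) 1 by rewrite sumr_const card_ord -natrX.
  rewrite -big_split; apply: ler_sum => i _.
  by have /andP[] := inv_sin2_bounds (basel_angle_bound (ltn_ord i)).
have -> : \sum_(i < 2 ^ n) inv_sq i.*2.+1 = S * (pi ^+ 2 / (16 * (4 ^ n)%:R)).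
  rewrite SE; have [/lt0r_neq0 + /lt0r_neq0] := (pi0, p0).
  by move: (pi : R) ((4 ^ n)%:R : R) (\sum_(i < _) _) => P q t P0 q1; field; rewrite P0 q1.
have k0 : 0 < (pi : R) ^+ 2 / (16 * (4 ^ n)%:R) by rewrite divr_gt0 ?exprn_gt0// mulr_gt0.
apply/andP; split.
  have -> : pi ^+ 2 / 8 - pi ^+ 2 / 16 / 2 ^+ n =
      (2 * (4 ^ n)%:R - 2 ^+ n) * (pi ^+ 2 / (16 * (4 ^ n)%:R)) :> R.
    by rewrite pq; move/lt0r_neq0: q0; move: (2 ^+ n) => q q1; field.
  by rewrite ler_pM2r//; lra.
have -> : pi ^+ 2 / 8 = (2 * (4 ^ n)%:R) * (pi ^+ 2 / (16 * (4 ^ n)%:R)) :> R.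
  by move/lt0r_neq0: p0; move: ((4 ^ n)%:R : R) => q q1; field.
by rewrite ler_pM2r.
Qed.

Lemma inv_sq_even_odd N : \sum_(0 <= m < N.*2.+1) inv_sq m =
  \sum_(i < N) inv_sq i.*2.+1 + 4^-1 * \sum_(0 <= m < N.+1) inv_sq m.
Proof.
elim: N => [|N IHN].
  by rewrite big_ord0 !big_nat1 /inv_sq invr0 expr0n mulr0 addr0.
rewrite doubleS big_nat_recr//= big_nat_recr//= IHN big_ord_recr /=
  [in RHS]big_nat_recr//= mulrDr.
have -> : inv_sq N.*2.+2 = 4^-1 * inv_sq N.+1.
  rewrite /inv_sq (_ : N.*2.+2%:R = 2 * N.+1%:R :> R); last by rewrite -natrM mul2n doubleS.
  by rewrite invfM exprMn; congr (_ * _); rewrite exprVn -natrX.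
ring.
Qed.

(** Separating odd and even terms sends a partial sum s to nearly pi^2/8 + s/4, a contraction with
    fixed point pi^2/6. The error of the odd part only halves at each step, hence the rate 2^-n. *)
Lemma inv_sq_partial_bound : exists B : R, forall n,
  `|\sum_(0 <= m < (2 ^ n).+1) inv_sq m - pi ^+ 2 / 6| <= B / 2 ^+ n.
Proof.
(* The second summand settles n = 0. The induction step needs pi^2/16 + B/4 <= B/2, that is, B >=
   pi^2/4. *)
exists (pi ^+ 2 / 4 + `|\sum_(0 <= m < 2) inv_sq m - pi ^+ 2 / 6|).
set B := _ + _; elim=> [|n IHn].
  by rewrite expn0 expr0 divr1 lerDr divr_ge0 ?sqr_ge0.
rewrite expnS mul2n inv_sq_even_odd.
have /andP[lo up] := odd_inv_sq_bounds n.
have q0 : 0 < (2 : R) ^+ n by rewrite exprn_gt0.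
have Bge : pi ^+ 2 / 4 <= B by rewrite lerDl.
have Bq : pi ^+ 2 / 4 / 2 ^+ n <= B / 2 ^+ n by rewrite ler_pM2r ?invr_gt0.
have -> : B / 2 ^+ n.+1 = B / 2 ^+ n / 2 by rewrite exprS; field; rewrite gt_eqF.
have E : pi ^+ 2 / 16 / 2 ^+ n = pi ^+ 2 / 4 / 2 ^+ n / 4 :> R by field; rewrite gt_eqF.
move: IHn lo up; rewrite E !ler_norml => /andP[h1 h2] lo up.
move: (pi ^+ 2 / 4 / 2 ^+ n) (B / 2 ^+ n) Bq h1 h2 lo up => x y *.
apply/andP; split; lra.
Qed.

Lemma basel : (\sum_(0 <= m <oo) (inv_sq m)%:E = (pi ^+ 2 / 6)%:E)%E.
Proof.
have [B HB] := inv_sq_partial_bound.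
have cvgR : (fun n => \sum_(0 <= m < (2 ^ n).+1) inv_sq m) @ \oo --> pi ^+ 2 / 6.
  apply/cvgrPdist_le => e e0; have := @cvg_geometric R B 2^-1.
  rewrite ger0_norm ?invr_ge0// invf_lt1// ltr1n => /(_ isT) /cvgrPdist_le /(_ e e0).
  apply: filterS => n /=; rewrite sub0r normrN => h.
  rewrite distrC; apply: le_trans (HB n) _; apply: le_trans h.
  by rewrite exprVn ler_norm.
have p2 : (fun n => (2 ^ n).+1) @ \oo --> \oo.
  apply/cvgnyPge => A; near=> n; apply: (@leq_trans n.+1).
    by apply: leqW; near: n; exact: nbhs_infty_ge.
  by rewrite ltnS ltnW// ltn_expl.
have ce : cvgn (fun N => \sum_(0 <= m < N) (inv_sq m)%:E)%E.
  by apply: is_cvg_nneseries => n _ _; rewrite lee_fin sqr_ge0.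
(* The series converges in the extended reals by positivity, so the subsequence of indices 2^n + 1
   determines its sum. *)
have h1 := cvg_comp _ _ p2 ce.
have h2 : (fun n => \sum_(0 <= m < (2 ^ n).+1) (inv_sq m)%:E)%E @ \oo --> (pi ^+ 2 / 6)%:E.
  by under eq_fun do rewrite sumEFin; apply: cvg_EFin cvgR => //; exact: nearW.
exact: (cvg_unique _ h1 h2).
Unshelve. all: by end_near. Qed.

End Basel.

(** * The sequence of invariants *)

Section SigmaSequence.
Variable R : realType.

Lemma SigmaE k j : (0 < k)%N -> (0 < j)%N ->
  (Sigma (zk_sub_wk R k) j =
   \sum_(0 <= m <oo) (sigma_term R (j.-1 %/ k).+1 m)%:E)%E.
Proof.
move=> k0; case: j => [|[|j]]// _; last exact: Sigma_higherE.
by rewrite div0n; exact: Sigma1E.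
Qed.

(** Termwise: c >= 1 gives m - c <= m - 1, so each term is at most m^-2. *)
Lemma Sigma_le_Sigma0 k j : (0 < k)%N -> (0 < j)%N ->
  (Sigma (zk_sub_wk R k) j <= Sigma (zk_sub_wk R k) 0)%E.
Proof.
move=> k0 j0; rewrite SigmaE// [leRHS]Sigma0E//.
apply: lee_nneseries => m _; first by rewrite lee_fin sqr_ge0.
rewrite lee_fin /sigma_term ler_pXn2r ?nnegrE ?divr_ge0 ?invr_ge0//.
case: m => [|[|m]]; rewrite ?mul0n ?muln0 ?invr0 ?mulr0 ?invr_ge0//.
rewrite natrM invfM mulrCA ler_piMr ?invr_ge0// ler_pdivrMr ?ltr0n//.
by rewrite mul1r ler_nat subSS leq_subr.
Qed.

Lemma Sigma_le_Sigma k i j : (0 < k)%N -> (0 < i)%N -> (i <= j)%N ->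
  (Sigma (zk_sub_wk R k) j <= Sigma (zk_sub_wk R k) i)%E.
Proof.
move=> k0 i0 ij; rewrite !SigmaE//; last by exact: leq_trans ij.
apply: lee_nneseries => m _; first by rewrite lee_fin sigma_term_ge0.
rewrite lee_fin /sigma_term ler_pXn2r ?nnegrE ?divr_ge0//.
rewrite ler_wpM2r ?invr_ge0// ler_nat leq_sub2l// ltnS leq_div2r//; lia.
Qed.

Lemma absz_ceil_div (j k : nat) : (0 < k)%N -> (0 < j)%N ->
  `|Num.ceil (j%:R / k%:R : rat)|%N = (j.-1 %/ k).+1.
Proof.
move=> k0 j0; suff -> : Num.ceil (j%:R / k%:R : rat) = (j.-1 %/ k).+1%:Z by [].
have k0' : (0 : rat) < k%:R by rewrite ltr0n.
apply: ceil_def; rewrite -addn1 PoszD addrK -!pmulrn.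
rewrite ltr_pdivlMr// ler_pdivrMr// -!natrM ltr_nat ler_nat addn1.
have := leq_divM j.-1 k; have := ltn_ceil j.-1 k0; lia.
Qed.

End SigmaSequence.

Theorem theorem4p1 (R : realType) (k : nat) (hk : (2 <= k)%N) :
  [/\ Sigma (zk_sub_wk R k) 0 = ((pi : R) ^+ 2 / 6%:R)%:E,
      (forall j : nat, (1 <= j)%N ->
        Sigma (zk_sub_wk R k) j =
        Sigma (zk_sub_wk R 1) `|Num.ceil (j%:R / k%:R : rat)|%N),
      (forall m i : nat, (1 <= m)%N -> (1 <= i <= k)%N ->
        Sigma (zk_sub_wk R k) (k * m - k + i)%N = Sigma (zk_sub_wk R 1) m)
    & (forall i j : nat, (i <= j)%N ->
        (Sigma (zk_sub_wk R k) j <= Sigma (zk_sub_wk R k) i)%E)].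
Proof.
have k0 : (0 < k)%N by exact: leq_trans hk.
split.
- by rewrite -basel; exact: Sigma0E.
(* Both series depend on their parameters only through c, and for k = 1 the order of the invariant
   is c itself. *)
- by move=> j j1; rewrite absz_ceil_div// !SigmaE// divn1.
- move=> m i m1 /andP[i1 ik]; rewrite !SigmaE//; last by rewrite addn_gt0 i1 orbT.
  rewrite (_ : (k * m - k + i).-1 %/ k = m.-1)%N ?divn1//.
  have -> : ((k * m - k + i).-1 = m.-1 * k + i.-1)%N.
    by rewrite -subn1 -(subn1 m) mulnBl mul1n mulnC; lia.
  by rewrite divnMDl// divn_small ?addn0//; lia.
- move=> [|i] [|j] ij //; first exact: Sigma_le_Sigma0.
  exact: Sigma_le_Sigma.
Qed.
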